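(* Let $\Delta_{n-1}$ denote the simplex on $n$ vertices. (i) For all integers $n \ge 8$ and $d$ with $2 \le d \le n-4$ there exists a collapsing sequence of $\Delta_{n-1}$ which gets stuck at a $d$-dimensional simplicial complex on $n$ vertices (i.e. a $d$-dimensional complex which contains all $n$ vertices and has no free faces). (ii) Let $n \geq 1$ and $d \ge 1$ be integers. If $n \le 7$ ($d$ arbitrary), or if $d \in \{1, n-3, n-2, n-1\}$ ($n$ arbitrary), then no collapsing sequence of $\Delta_{n-1}$ gets stuck at dimension $d$.
   Context: A simplicial complex on a finite ground set $V$ is a collection of subsets of $V$ (called faces) closed under taking subsets. The dimension of a face $\tau$ is $|\tau|-1$, and the dimension of a complex is the maximum dimension of its faces. $\Delta_{n-1}$ is the complex on $\{1,\dots,n\}$ in which every subset is a face. A nonempty face of $X$ is free if it is a proper subset of exactly one other face of $X$. An elementary collapse of $X$ is the removal of a free face together with the unique face properly containing it. A collapsing sequence is a finite (possibly empty) sequence of elementary collapses. A collapsing sequence on $X$ gets stuck at a complex $Y$ if it reduces $X$ to $Y$ and $Y$ has no free faces; it gets stuck at dimension $d$ if it gets stuck at some $d$-dimensional complex. *)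

(* Defs.v *)
From HB Require Import structures.
From mathcomp Require Import all_boot all_order all_algebra.

Set Implicit Arguments.
Unset Strict Implicit.
Unset Printing Implicit Defensive.

Section Collapsibility.

Variable V : finType.
Implicit Types (X Y : {set {set V}}) (s t : {set V}) (d : int).

Definition simplicial_complex X : bool :=
  [forall s in X, forall t : {set V}, (t \subset s) ==> (t \in X)].

Definition full_simplex : {set {set V}} := [set: {set V}].

(* Integer-valued: the empty face has dimension -1. *)
Definition face_dim s : int := (#|s|%:Z - 1)%R.

(* The initial value -1 is the least possible dimension of a face, so it only
   matters for the void family, which no collapse of a simplex produces. *)
Definition complex_dim X : int := \big[Order.max/(-1)%R]_(s in X) face_dim s.

Definition free_face X s : bool :=
  [&& s \in X, s != set0 & #|[set t in X | s \proper t]| == 1].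

Definition elementary_collapse : rel {set {set V}} := fun X Y =>
  [exists s : {set V}, exists t : {set V},
    [&& free_face X s, t \in X, s \proper t & Y == X :\: [set s; t]]].

(* A sequence of collapses is recorded by the complexes obtained after each
   step; the starting complex X is not listed in Xs. *)
Definition collapsing_sequence X (Xs : seq {set {set V}}) : bool :=
  path elementary_collapse X Xs.

Definition gets_stuck_at X (Xs : seq {set {set V}}) Y : Prop :=
  [/\ collapsing_sequence X Xs, last X Xs = Y & forall s, ~~ free_face Y s].

Definition gets_stuck_at_dim X (Xs : seq {set {set V}}) d : Prop :=
  exists Y, [/\ gets_stuck_at X Xs Y, simplicial_complex Y & complex_dim Y = d].

Lemma full_simplex_complex : simplicial_complex full_simplex.
Proof. by apply/forall_inP=> s _; apply/forallP=> t; rewrite inE implybT. Qed.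

Lemma elementary_collapse_complex X Y :
  elementary_collapse X Y -> simplicial_complex X -> simplicial_complex Y.
Proof.
case/existsP=> s /existsP[t /and4P[/and3P[_ _ /cards1P[w wE]] tX st /eqP->]].
have supE u : u \in X -> s \proper u -> u = t.
  move=> uX su; have : t \in [set w] by rewrite -wE inE tX.
  have : u \in [set w] by rewrite -wE inE uX.
  by rewrite !inE => /eqP-> /eqP->.
move=> /forall_inP cX; apply/forall_inP=> u; rewrite !inE negb_or.
case/andP=> /andP[us ut] uX; apply/forallP=> v; apply/implyP=> vu.
have vX : v \in X by have /forallP/(_ v)/implyP := cX u uX; apply.
rewrite !inE vX andbT negb_or.
apply/andP; split; apply: contraNneq ut => vE; subst v.
- by rewrite (supE u uX) // properEneq vu eq_sym us.
- by rewrite (supE u uX) // (proper_sub_trans st vu).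
Qed.

Lemma collapsing_sequence_complex X Xs :
  simplicial_complex X -> collapsing_sequence X Xs ->
  simplicial_complex (last X Xs).
Proof.
elim: Xs X => [|Y Xs IH] X //= cX /andP[XY]; apply: IH.
exact: elementary_collapse_complex XY cX.
Qed.

End Collapsibility.

Arguments full_simplex V : clear implicits.

(* Main.v *)
(** (i) Call a complex without free faces stuck.  Two operations add a new vertex
    to a stuck complex and keep it a collapse of the simplex on its vertices: the
    one-point suspension raises the dimension by one, and the stellar subdivision of a facet preserves it.  So,
    starting from eight-vertex examples of dimensions 2, 3 and 4, the pair
    (n + 1, d) comes from (n, d) by a subdivision if [d <= n - 4], and from
    (n, d - 1) by a suspension if [d = n - 3].

    (ii) A collapse of a simplex has vanishing reduced homology over F_2, so the
    family [B] of its top-dimensional faces contains no nonempty cycle; if it is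
    stuck, no ridge lies in exactly one member of [B].  In codimension at most 2
    (relative to the full simplex) [B] itself is a cycle; in codimension 3 the
    complements of the members of [B] are the edges of a complete multipartite
    graph, and a cut of that graph is a cycle.  Since cycles are determined by
    their ridges off a vertex, [B] has at most as many members as it has ridges
    off any vertex; double counting then settles dimension 1, and dimension 2 on
    at most 7 vertices up to one configuration, which contains a cycle.  In
    dimension 3 on 7 vertices, the complements of [B] are a family of triples of
    which no 4-set contains exactly one, and a search shows that such a family
    contains the coboundary of a graph, which is again a cycle. *)

From HB Require Import structures.
From mathcomp Require Import all_boot all_order all_algebra zify.
Require Import Defs.

Set Implicit Arguments.
Unset Strict Implicit.
Unset Printing Implicit Defensive.

Import Order.TTheory.

(** * Collapse certificates on bit sequences *)

Fixpoint bitseqs k : seq bitseq :=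
  if k is k'.+1 then map (cons false) (bitseqs k') ++ map (cons true) (bitseqs k')
  else [:: [::]].

Lemma mem_bitseqs k m : (m \in bitseqs k) = (size m == k).
Proof.
have consI (b : bool) : injective (cons b) by move=> ? ? [].
elim: k m => [|k IH] [|b m] //; rewrite mem_cat; first by apply/orP=> -[]/mapP[].
rewrite eqSS -IH; have nmem b' : b != b' -> b :: m \notin map (cons b') (bitseqs k).
  by move=> bb'; apply/mapP=> -[w _ [bE]]; rewrite bE eqxx in bb'.
by case: b nmem => nmem; rewrite (mem_map (consI _)) (negPf (nmem _ _)) ?orbF.
Qed.

Definition code_link (C : seq bitseq) (m : bitseq) :=
  [seq i <- iota 0 (size m) | ~~ nth false m i && (set_nth false m i true \in C)].

(* Each entry of [ms] is removed together with its unique coface.  The run stops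
   at the first entry that is not free, so that every outcome is a collapse. *)
Fixpoint collapse_along n C (ms : seq bitseq) : seq bitseq :=
  if ms is m :: ms' then
    if (has id m, size m == n, code_link C m) is (true, true, [:: i]) then
      collapse_along n [seq w <- C | w \notin [:: m; set_nth false m i true]] ms'
    else C
  else C.

(** The four tests match the last four clauses of [sticks_at]. *)
Definition sticks_check n ms d :=
  let C := collapse_along n (bitseqs n) ms in
  [&& all (fun m => has id m ==> (size (code_link C m) != 1)) (bitseqs n),
      all (fun m => count id m <= d.+1) C,
      has (fun m => (size m == n) && (count id m == d.+1)) C
    & all (fun i => set_nth false (nseq n false) i true \in C) (iota 0 n)].

(** * Collapses and stuck complexes *)

Section Collapses.
Variable V : finType.
Implicit Types (A X Y Z : {set {set V}}) (s t F U : {set V}) (u v x y : V).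

Lemma complexP X :
  reflect (forall s t, s \in X -> t \subset s -> t \in X) (simplicial_complex X).
Proof.
apply: (iffP forall_inP) => [cX s t /cX/forallP/(_ t)/implyP//|cX s sX].
by apply/forallP=> t; apply/implyP; apply: cX.
Qed.

(* The vertex set of the usual link.  In a complex, a nonempty [s] is free iff it
   has exactly one element. *)
Definition link X s := [set x | (x \notin s) && (x |: s \in X)].

(** Sets outside [X] do no harm: in a complex their link is empty. *)
Definition stuck X := forall s, s != set0 -> #|link X s| != 1.

Lemma proper_setU1 x s : x \notin s -> s \proper x |: s.
Proof. by move=> xs; rewrite properUr // sub1set. Qed.

(** For any [z] in the coface [t] outside [s], closure makes [z |: s] a coface too, so uniqueness
    forces [t] to have just one more vertex than [s]. *)
Lemma free_face_link X s :
  simplicial_complex X -> free_face X s -> s != set0 /\ #|link X s| = 1.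
Proof.
move=> /complexP cX /and3P[sX s0 /cards1P[t tE]]; split=> //.
have tP w : (w \in X) && (s \proper w) = (w == t) by rewrite -in_set1 -tE inE.
have /andP[tX st] : (t \in X) && (s \proper t) by rewrite tP.
have /properP[sst [x xt xs]] := st.
apply/eqP/cards1P; exists x; apply/setP=> y; rewrite !inE.
have addX z : z \in t -> z |: s \in X.
  by move=> zt; apply: cX tX _; rewrite subUset sub1set zt.
apply/andP/eqP=> [[ys yX]|->]; last by split=> //; apply: addX.
have eqt z : z \notin s -> z |: s \in X -> z |: s = t.
  by move=> zs zX; apply/eqP; rewrite -tP zX proper_setU1.
have : x \in y |: s by rewrite eqt.
by rewrite !inE (negPf xs) orbF => /eqP.
Qed.

Lemma link_free_face X s :
  simplicial_complex X -> s != set0 -> #|link X s| = 1 -> free_face X s.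
Proof.
move=> /complexP cX s0 /eqP/cards1P[x xE].
have xP y : (y \notin s) && (y |: s \in X) = (y == x).
  by rewrite -in_set1 -xE inE.
have /andP[xs xX] : (x \notin s) && (x |: s \in X) by rewrite xP.
rewrite /free_face s0 (cX _ _ xX) ?subsetUr //=.
apply/cards1P; exists (x |: s); apply/setP=> t; rewrite !inE.
apply/andP/eqP=> [[tX st]|->]; last by rewrite proper_setU1.
have addt y : y \in t -> y \notin s -> y = x.
  move=> yt ys; apply/eqP; rewrite -xP ys (cX _ _ tX) //.
  by rewrite subUset sub1set yt proper_sub.
have [sst [z zt zs]] := properP st; have zx := addt z zt zs.
apply/eqP; rewrite eqEsubset subUset sub1set -{2}zx zt sst !andbT.
apply/subsetP=> y yt; rewrite !inE; case: (boolP (y \in s)) => ys.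
  by rewrite orbT.
by rewrite (addt y) // eqxx.
Qed.

Lemma stuckP X :
  simplicial_complex X -> stuck X <-> (forall s, ~~ free_face X s).
Proof.
move=> cX; split=> nX s; last first.
  by move=> s0; apply: contra (nX s) => /eqP; apply: link_free_face.
by apply/negP=> /(free_face_link cX)[/nX/eqP].
Qed.

Lemma setU1D1 a x s : x != a -> (x |: s) :\ a = x |: (s :\ a).
Proof.
move=> xa; apply/setP=> y; rewrite !inE.
by case: (eqVneq y x) => [->|]; rewrite ?xa.
Qed.

(** Requiring [X'] to be a complex encodes the freeness of [s]: any further coface would survive in
    [X'] and force [s] to stay. *)
Definition cstep X X' :=
  [/\ simplicial_complex X, simplicial_complex X' &
    exists s x, [/\ s != set0, x \notin s, s \notin X', x |: s \notin X' &
      X = X' :|: [set s; x |: s]]].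

Lemma cstep_elementary X X' : cstep X X' -> elementary_collapse X X'.
Proof.
case=> [/complexP cX /complexP cX' [s [x [s0 xs sX' xsX' XE]]]].
have inX t : (t \in X) = [|| t \in X', t == s | t == x |: s] by rewrite XE !inE.
have st := proper_setU1 xs.
apply/existsP; exists s; apply/existsP; exists (x |: s); apply/and4P; split=> //.
- apply/and3P; split=> //; first by rewrite inX eqxx orbT.
  apply/cards1P; exists (x |: s); apply/setP=> t; rewrite !inE.
  apply/andP/eqP=> [[]|->]; last by rewrite inX eqxx !orbT.
  rewrite inX => /or3P[tX' sst|/eqP->|/eqP//]; last by rewrite properxx.
  by case/negP: sX'; apply: cX' tX' (proper_sub sst).
- by rewrite inX eqxx !orbT.
apply/eqP/setP=> t; rewrite inE inX !inE.
have [->|ts] := eqVneq t s; first by rewrite (negPf sX').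
have [->|txs] := eqVneq t (x |: s); first by rewrite (negPf xsX').
by rewrite !orbF.
Qed.

Lemma elementary_cstep X X' :
  simplicial_complex X -> elementary_collapse X X' -> cstep X X'.
Proof.
move=> cX XX'; have cX' := elementary_collapse_complex XX' cX.
split=> //; case/existsP: XX' => s /existsP[t /and4P[fs tX st /eqP XE]].
have [s0 _] := free_face_link cX fs.
case/and3P: fs => sX _ /cards1P[w wE].
have tP r : (r \in X) && (s \proper r) = (r == t).
  have /set1P-> : t \in [set w] by rewrite -wE inE tX.
  by rewrite -in_set1 -wE inE.
have /properP[sst [x xt xs]] := st.
have xsE : x |: s = t.
  apply/eqP; rewrite -tP proper_setU1 // andbT; move/complexP: cX => cX.
  by apply: cX tX _; rewrite subUset sub1set xt.
exists s, x; rewrite xsE; split=> //; rewrite XE ?inE ?eqxx ?orbT //.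
by apply/setP=> r; rewrite !inE; do 2?case: eqVneq => [->|_]; rewrite ?orbT ?orbF.
Qed.

Inductive collapses : {set {set V}} -> {set {set V}} -> Prop :=
| collapses_refl X : collapses X X
| collapses_step X X' Y : cstep X X' -> collapses X' Y -> collapses X Y.

Lemma collapses_trans Y X Z : collapses X Y -> collapses Y Z -> collapses X Z.
Proof. by elim=> // {Y} X1 X2 Y XX _ IH /IH; apply: collapses_step. Qed.

Lemma collapses_seq X Y :
  collapses X Y -> exists2 Xs, collapsing_sequence X Xs & last X Xs = Y.
Proof.
elim=> [{}X|{}X X' {}Y /cstep_elementary XX' _ [Xs pXs lXs]]; first by exists [::].
by exists (X' :: Xs) => //=; rewrite /collapsing_sequence /= XX'.
Qed.

Lemma seq_collapses X Xs :
  simplicial_complex X -> collapsing_sequence X Xs -> collapses X (last X Xs).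
Proof.
elim: Xs X => [|X' Xs IH] X cX /=; first by move=> _; apply: collapses_refl.
case/andP=> XX' pX; apply: (collapses_step (elementary_cstep cX XX')).
exact: IH (elementary_collapse_complex XX' cX) pX.
Qed.

Lemma collapses_sub X Y : collapses X Y -> Y \subset X.
Proof.
elim=> // {}X X' {}Y [_ _ [s [x [_ _ _ _ ->]]]] _ /subset_trans; apply.
exact: subsetUl.
Qed.

Lemma collapses_complex X Y :
  collapses X Y -> simplicial_complex X -> simplicial_complex Y.
Proof. by elim=> // {}X X' {}Y [] _ cX' _ _ IH _; apply: IH. Qed.

Lemma powerset_complex U : simplicial_complex (powerset U).
Proof. by apply/complexP=> s t; rewrite !inE => sU /subset_trans; apply. Qed.

(** * Collapses of cones and joins *)

Definition cone U u A := [set t in powerset U | t :\ u \in A].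

Lemma cone_complex U u A :
  simplicial_complex A -> simplicial_complex (cone U u A).
Proof.
move=> /complexP cA; apply/complexP=> s t; rewrite !inE => /andP[sU sA] ts.
by rewrite (subset_trans ts) //= (cA _ _ sA) // setSD.
Qed.

(* The pairs (s, u |: s) with s in B but not in A are removed, largest s first. *)
Lemma cone_collapses U u A B :
    u \in U -> simplicial_complex A -> simplicial_complex B ->
    set0 \in A -> A \subset B -> B \subset powerset (U :\ u) ->
  collapses (cone U u B) (cone U u A).
Proof.
move=> uU cA + A0; move: {-1}#|_| (leqnn #|B :\: A|) => n.
elim: n B => [|n IH] B leBn cB AB BU.
  rewrite leqn0 cards_eq0 setD_eq0 in leBn.
  have -> : B = A by apply/eqP; rewrite eqEsubset leBn.
  exact: collapses_refl.
case: (set_0Vmem (B :\: A)) => [BA0|[s0 s0BA]].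
  by apply: IH => //; rewrite BA0 cards0.
case: (arg_maxnP (fun s : {set V} => #|s|) s0BA) => s sBA smax.
have /setDP[sB sA] := sBA.
have us : u \notin s.
  by have := subsetP BU s sB; rewrite inE subsetD1 => /andP[].
(* A face of [B] properly containing [s] is not in [A], which is closed and misses [s]; so it would
   contradict the maximality of [#|s|]. *)
have cB' : simplicial_complex (B :\ s).
  apply/complexP=> t r; rewrite !inE => /andP[ts tB] rt.
  rewrite (complexP _ cB _ _ tB rt) andbT; apply: contraNneq sA => rs.
  have [tA|tA] := boolP (t \in A).
    by apply: (complexP _ cA _ _ tA); rewrite -rs.
  have /smax : t \in B :\: A by rewrite inE tA.
  by rewrite /= leqNgt (proper_card (_ : s \proper t)) // properEneq eq_sym ts -rs.
have sK : (u |: s) :\ u = s by rewrite setU1K.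
have s_u : s :\ u = s by apply/setDidPl; rewrite disjoint_sym disjoints1.
apply: collapses_step (_ : collapses (cone U u (B :\ s)) _); last first.
  apply: IH => //.
  - rewrite setDDl setUC -setDDl -ltnS; apply: leq_trans leBn.
    by apply: proper_card; rewrite properD1.
  - by rewrite subsetD1 AB.
  - exact: subset_trans (subsetDl _ _) BU.
split; [exact: cone_complex|exact: cone_complex|exists s, u; split=> //].
- by apply: contraNneq sA => ->.
- by rewrite !inE s_u eqxx andbF.
- by rewrite !inE sK eqxx andbF.
have sU : s \subset U.
  by have := subsetP BU s sB; rewrite inE subsetD1 => /andP[].
apply/setP=> t; rewrite !inE.
have [tE|tE] := eqVneq (t :\ u) s.
  rewrite tE sB andbF andbT /=.
  have [ut|ut] := boolP (u \in t).
    by rewrite -tE setD1K // eqxx orbT -(setD1K ut) tE subUset sub1set uU sU.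
  move: tE; rewrite (setDidPl _) => [->|]; last by rewrite disjoint_sym disjoints1.
  by rewrite eqxx sU.
rewrite /=; case: (eqVneq t s) tE => [->|_]; first by rewrite s_u eqxx.
by case: (eqVneq t (u |: s)) => [->|_]; rewrite ?sK ?eqxx ?orbF.
Qed.

Lemma powerset_cone U u : u \in U -> powerset U = cone U u (powerset (U :\ u)).
Proof.
move=> uU; apply/setP=> t; rewrite !inE; case: (boolP (t \subset U)) => //= tU.
by rewrite setSD.
Qed.

(* The complex [A] together with the cone with apex [v] over [Z]. *)
Definition join v A Z := [set t : {set V} | if v \in t then t :\ v \in Z else t \in A].

Lemma join_complex v A Z :
  simplicial_complex A -> simplicial_complex Z -> Z \subset A ->
  simplicial_complex (join v A Z).
Proof.
move=> /complexP cA /complexP cZ /subsetP ZA; apply/complexP=> s t; rewrite !inE.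
case: ifP => [vs sZ ts|vs sA ts].
  case: ifP => [vt|/negbT vt]; first by apply: cZ sZ _; apply: setSD.
  by apply/ZA/(cZ _ _ sZ); rewrite subsetD1 ts.
case: ifP => [vt|_]; last exact: cA sA ts.
by rewrite (subsetP ts _ vt) in vs.
Qed.

Lemma join_powerset v U :
  v \notin U -> join v (powerset U) (powerset U) = powerset (v |: U).
Proof.
move=> vU; apply/setP=> t; rewrite !inE; case: ifP => vt.
  by rewrite subDset.
apply/idP/idP=> [/subset_trans|]; first by apply; apply: subsetUr.
move=> /subsetP tU; apply/subsetP=> x xt; have := tU x xt; rewrite !inE.
by case: eqP => // xv; rewrite -xv xt in vt.
Qed.

(** Each pair removed from [Z] is removed from the join with [v] added to both faces. *)
Lemma join_collapsesr v A Z Z' :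
    simplicial_complex A -> (forall t, t \in A -> v \notin t) ->
    Z \subset A -> collapses Z Z' ->
  collapses (join v A Z) (join v A Z').
Proof.
move=> cA vA ZA ZZ; elim: ZZ ZA => [{}Z _|{}Z Z1 {}Z' stepZ _ IH ZA].
  exact: collapses_refl.
have [cZ cZ1 [s [x [s0 xs sZ1 xsZ1 ZE]]]] := stepZ.
have Z1A : Z1 \subset A by apply: subset_trans ZA; rewrite ZE subsetUl.
apply: collapses_step (IH Z1A); split; try exact: join_complex.
have : v \notin x |: s by apply/vA/(subsetP ZA); rewrite ZE !inE eqxx !orbT.
rewrite !inE negb_or => /andP[vx vs].
have vxs : v \notin x |: s by rewrite !inE negb_or vx.
exists (v |: s), x; split.
- by apply/set0Pn; exists v; rewrite !inE eqxx.
- by rewrite !inE negb_or eq_sym vx.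
- by rewrite !inE eqxx setU1K.
- by rewrite setUCA !inE eqxx setU1K.
apply/setP=> t; rewrite setUCA !inE ZE; case: ifP => vt.
  have inj (w : {set V}) : v \notin w -> (t == v |: w) = (t :\ v == w).
    by move=> vw; apply/eqP/eqP=> [->|<-]; rewrite ?setU1K ?setD1K.
  by rewrite !inE !inj.
have neq w : (t == v |: w) = false.
  by apply/eqP=> tE; rewrite tE !inE eqxx in vt.
by rewrite !neq !orbF.
Qed.

(** Since [Z] stays inside [A'], a pair removed from [A] has no coface through [v], and the same
    pair can be removed from the join. *)
Lemma join_collapsesl v A A' Z :
    simplicial_complex Z -> (forall t, t \in A -> v \notin t) ->
    Z \subset A' -> collapses A A' ->
  collapses (join v A Z) (join v A' Z).
Proof.
move=> cZ vA ZA' AA'; elim: AA' vA ZA' => [|{}A A1 {}A' stepA A1A' IH vA ZA'].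
  by move=> *; apply: collapses_refl.
have [cA cA1 [s [x [s0 xs sA1 xsA1 AE]]]] := stepA.
have A1A : A1 \subset A by rewrite AE subsetUl.
have ZA1 := subset_trans ZA' (collapses_sub A1A').
apply: collapses_step (IH _ ZA'); last first.
  by move=> t tA1; apply/vA/(subsetP A1A).
split; try by apply: join_complex => //; apply: subset_trans A1A.
have : v \notin x |: s by apply: vA; rewrite AE !inE eqxx !orbT.
rewrite !inE negb_or => /andP[vx vs].
have vxs : v \notin x |: s by rewrite !inE negb_or vx.
exists s, x; split=> //.
- by rewrite !inE (negPf vs).
- by rewrite inE (negPf vxs).
apply/setP=> t; rewrite !inE AE !inE; case: ifP => // vt.
have neq (w : {set V}) : v \notin w -> (t == w) = false.
  by move=> vw; apply/eqP=> tE; rewrite -tE vt in vw.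
by rewrite !neq ?orbF.
Qed.

(** * Adding a vertex: suspension and subdivision *)

Definition sticks_at U d := exists Y,
  [/\ collapses (powerset U) Y, stuck Y, forall t, t \in Y -> #|t| <= d.+1,
      exists2 F, F \in Y & #|F| = d.+1 & forall x, x \in U -> [set x] \in Y].

(* The suspension of [Y] at [u] consists of the [t] with [t :\ v \in Y] (if
   [v \in t]) or [t :\ u \in Y] (if not): it is the join of a cone with apex [u]
   and of [Y], and both are collapses of the simplex. *)
Lemma one_point_suspension U v d :
  v \notin U -> 1 < #|U| -> sticks_at U d -> sticks_at (v |: U) d.+1.
Proof.
move=> vU U2 [Y [colY stuckY dimY [F FY cF] vertY]].
have cY := collapses_complex colY (powerset_complex U).
have YU t : t \in Y -> t \subset U.
  by move/(subsetP (collapses_sub colY)); rewrite inE.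
have [u uU] : exists u, u \in U by apply/card_gt0P; apply: ltnW.
have uv : u != v by apply: contraNneq vU => <-.
have Y0 : set0 \in Y by apply: (complexP _ cY _ _ FY); apply: sub0set.
pose A := cone U u (Y :&: powerset (U :\ u)).
have AE t : (t \in A) = (t :\ u \in Y).
  rewrite !inE; apply/andP/idP=> [[_ /andP[]]//|tY].
  have := YU _ tY; rewrite subDset => tU.
  by rewrite tY setSD ?(subset_trans tU) // subUset sub1set uU subxx.
have cA' : simplicial_complex (Y :&: powerset (U :\ u)).
  apply/complexP=> s t; rewrite !inE => /andP[sY sU] ts.
  by rewrite (complexP _ cY _ _ sY ts) (subset_trans ts).
have colA : collapses (powerset U) A.
  rewrite (powerset_cone uU); apply: cone_collapses => //.
  - exact: powerset_complex.
  - by rewrite !inE Y0 sub0set.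
  - exact: subsetIr.
have YA : Y \subset A.
  by apply/subsetP=> t tY; rewrite AE (complexP _ cY _ _ tY) // subsetDl.
pose Y' := join v A Y.
have Y'E t : (t \in Y') = if v \in t then t :\ v \in Y else t :\ u \in Y.
  by rewrite inE AE.
have vnU t : t \in powerset U -> v \notin t.
  by rewrite inE => /subsetP tU; apply: contraNN vU; apply: tU.
have colY' : collapses (powerset (v |: U)) Y'.
  rewrite -join_powerset //.
  apply: (@collapses_trans (join v (powerset U) Y)).
    by apply: join_collapsesr colY => //; apply: powerset_complex.
  by apply: join_collapsesl colA.
clearbody Y'.
have vY t : v \in t -> t \notin Y.
  by move=> vt; apply/negP=> /YU/subsetP/(_ v vt); apply/negP.
exists Y'; split=> //.
- move=> s s0; have [vs|vs] := boolP (v \in s).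
    have -> : link Y' s = link Y (s :\ v).
      apply/setP=> x; rewrite !inE Y'E !inE vs orbT.
      have [->|xv] := eqVneq x v; first by rewrite vs setD1K // (negPf (vY _ vs)).
      by rewrite setU1D1.
    (* The link of [v] alone contains all of [U], hence at least two vertices. *)
    have [s1|/stuckY//] := eqVneq (s :\ v) set0.
    rewrite neq_ltn orbC (leq_trans U2) //; apply/subset_leq_card/subsetP=> x xU.
    by rewrite s1 inE inE setU0 vertY.
  have [us|us] := boolP (u \in s).
    (* In this link [v] takes the place of [u]. *)
    have -> : #|link Y' s| = #|link Y (s :\ u)|.
      rewrite (cardsD1 v) [RHS](cardsD1 u); congr (_ + _).
        by rewrite !inE Y'E !inE vs !eqxx setU1K //= setD1K.
      apply: eq_card => x; rewrite !inE Y'E !inE.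
      have [->|xv] := eqVneq x v.
        have /vY/negPf-> : v \in v |: (s :\ u) by rewrite !inE eqxx.
        by rewrite !andbF.
      rewrite (negPf vs) /=.
      have [->|xu] := eqVneq x u; first by rewrite us.
      by rewrite setU1D1.
    have [s1|/stuckY//] := eqVneq (s :\ u) set0.
    rewrite neq_ltn orbC (leq_trans U2) //; apply/subset_leq_card/subsetP=> x xU.
    by rewrite s1 inE inE setU0 vertY.
  have s_u : s :\ u = s by apply/setDidPl; rewrite disjoint_sym disjoints1.
  (* A face of [Y] avoiding both [u] and [v] has both in its link. *)
  have [sY|sY] := boolP (s \in Y).
    rewrite neq_ltn orbC -(_ : #|[set u; v]| = 2); last by rewrite cards2 uv.
    apply/orP; left; apply/subset_leq_card/subsetP=> x; rewrite !inE Y'E !inE.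
    case/orP=> /eqP->; last by rewrite vs eqxx setU1K.
    by rewrite us (negPf vs) eq_sym (negPf uv) setU1K.
  rewrite (_ : link Y' s = set0) ?cards0 //; apply/setP=> x; rewrite !inE Y'E !inE.
  rewrite (negPf vs) orbF; case: eqVneq => [<-|xv].
    by rewrite setU1K // (negPf sY) andbF.
  apply: contraNF sY => /andP[xs xsY].
  by apply: (complexP _ cY _ _ xsY); rewrite subsetD1 subsetUr.
- move=> t; rewrite Y'E; case: ifP => [vt|_] /dimY.
    by rewrite [in X in _ -> X](cardsD1 v) vt.
  by rewrite [in X in _ -> X](cardsD1 u); case: (u \in t) => //; apply: leqW.
- have vF : v \notin F by apply/contraL/vY: FY.
  exists (v |: F); last by rewrite cardsU1 vF cF.
  by rewrite Y'E !inE eqxx setU1K.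
move=> x; rewrite !inE Y'E inE; case: eqVneq => [->|xv] /=.
  by rewrite setDv Y0.
move=> /vertY xY.
exact: (complexP _ cY _ _ xY (subsetDl _ _)).
Qed.

(* [Y] and the cone with apex [v] over the facet [F] are reached first; then [F] is
   free in [v |: F], and their removal leaves the stellar subdivision. *)
Lemma facet_subdivision U v d :
  v \notin U -> 0 < d -> sticks_at U d -> sticks_at (v |: U) d.
Proof.
move=> vU d0 [Y [colY stuckY dimY [F FY cF] vertY]].
have cY := collapses_complex colY (powerset_complex U).
have YU t : t \in Y -> t \subset U.
  by move/(subsetP (collapses_sub colY)); rewrite inE.
have vnY t : t \in Y -> v \notin t.
  by move/YU/subsetP=> tU; apply: contraNN vU; apply: tU.
have vnU t : t \in powerset U -> v \notin t.
  by rewrite inE => /subsetP tU; apply: contraNN vU; apply: tU.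
have [u uF] : exists u, u \in F by apply/card_gt0P; rewrite cF.
have uU : u \in U := subsetP (YU _ FY) u uF.
(* Both simplices are cones with apex [u]. *)
have colF : collapses (powerset U) (powerset F).
  have -> : powerset F = cone U u (powerset (F :\ u)).
    apply/setP=> t; rewrite !inE; apply/idP/andP=> [tF|[_]].
      by rewrite setSD // (subset_trans tF (YU _ FY)).
    by rewrite subDset setD1K.
  rewrite (powerset_cone uU).
  apply: cone_collapses; rewrite ?powerset_complex ?inE ?sub0set //.
  by rewrite powersetS setSD ?YU.
have vF := vnY _ FY.
have maxF x : x \notin F -> x |: F \notin Y.
  by move=> xF; apply/negP=> /dimY; rewrite cardsU1 xF cF ltnn.
have FSY : powerset F \subset Y.
  by apply/subsetP=> t; rewrite inE; apply: (complexP _ cY).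
pose Y' := [set t : {set V} | if v \in t then t :\ v \proper F else (t \in Y) && (t != F)].
have cY' : simplicial_complex Y'.
  apply/complexP=> s t; rewrite !inE; case: ifP => [vs sF ts|vs /andP[sY sF] ts].
    case: ifP => [vt|/negbT vt].
      by apply: sub_proper_trans sF; apply: setSD.
    have tF : t \proper F.
      by apply: sub_proper_trans sF; rewrite subsetD1 ts.
    rewrite (complexP _ cY _ _ FY (proper_sub tF)) /=.
    by apply: contraTneq tF => ->; rewrite properxx.
  case: ifP => [vt|_]; first by rewrite (subsetP ts _ vt) in vs.
  rewrite (complexP _ cY _ _ sY ts) /=; apply: contraNneq sF => tF.
  by rewrite eq_sym -tF eqEcard ts tF cF dimY.
have colY' : collapses (powerset (v |: U)) Y'.
  rewrite -join_powerset //.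
  apply: (@collapses_trans (join v (powerset U) (powerset F))).
    by apply: join_collapsesr => //; apply: powerset_complex.
  apply: (@collapses_trans (join v Y (powerset F))).
    by apply: join_collapsesl => //; apply: powerset_complex.
  apply: collapses_step (collapses_refl _); split=> //.
    by apply: join_complex => //; apply: powerset_complex.
  exists F, v; split=> //.
  - by apply/set0Pn; exists u.
  - by rewrite !inE (negPf vF) eqxx andbF.
  - by rewrite !inE eqxx setU1K // properxx.
  apply/setP=> t; rewrite !inE; case: ifP => vt.
    have -> : (t == F) = false by apply: contraTF vt => /eqP->.
    rewrite properEneq; have -> : (t == v |: F) = (t :\ v == F).
      by apply/eqP/eqP=> [->|<-]; rewrite ?setU1K ?setD1K.
    by case: eqVneq => [->|_]; rewrite ?subxx ?orbF.
  have -> : (t == v |: F) = false by apply: contraFF vt => /eqP->; rewrite !inE eqxx.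
  by case: eqVneq => //= [->|]; rewrite ?FY ?andbT ?orbF.
have Y'E t : (t \in Y') = if v \in t then t :\ v \proper F else (t \in Y) && (t != F).
  by rewrite inE.
clearbody Y'.
have two s x y : x \in link Y' s -> y \in link Y' s -> x != y -> #|link Y' s| != 1.
  move=> xs ys xy; rewrite neq_ltn orbC; apply/orP; left.
  have <- : #|[set x; y]| = 2 by rewrite cards2 xy.
  by apply/subset_leq_card; rewrite subUset !sub1set xs.
exists Y'; split=> //.
- have nvY t : v \in t -> (t \in Y) = false.
    by move=> vt; apply: contraTF vt => /vnY.
  move=> s s0; have [vs|vs] := boolP (v \in s).
    have linkE x : (x \in link Y' s) = (x \notin s) && (x |: (s :\ v) \proper F).
      rewrite inE Y'E !inE vs orbT; case: (boolP (x \in s)) => //= xs.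
      by rewrite setU1D1 //; apply: contraNneq xs => ->.
    have [/properP[sF [y yF ys]]|nsF] := boolP (s :\ v \proper F); last first.
      rewrite (_ : link Y' s = set0) ?cards0 //; apply/setP=> x; rewrite linkE inE.
      by apply: contraNF nsF => /andP[_]; apply: sub_proper_trans; apply: subsetUr.
    have notins z : z \in F -> z \notin s :\ v -> z \notin s.
      by move=> zF; rewrite !inE negb_and negbK => /orP[/eqP zv|//]; rewrite -zv zF in vF.
    have subF z : z \in F -> z |: (s :\ v) \subset F by rewrite subUset sub1set => ->.
    (* If [y] completes [s :\ v] to [F], then [s] is a facet; otherwise [y] and another vertex [z]
       of [F] both extend [s]. *)
    have [yE|yF'] := eqVneq (y |: (s :\ v)) F.
      rewrite (_ : link Y' s = set0) ?cards0 //; apply/setP=> x; rewrite linkE inE.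
      apply/negP=> /andP[xs xF].
      have : x \in F by apply: (subsetP (proper_sub xF)); rewrite !inE eqxx.
      rewrite -yE !inE (negPf xs) andbF orbF => /eqP xy.
      by rewrite xy yE properxx in xF.
    have yp : y |: (s :\ v) \proper F by rewrite properEneq yF' subF.
    have [_ [z zF]] := properP yp; rewrite in_setU1 negb_or => /andP[zy zs].
    apply: (two _ z y) => //; rewrite linkE notins //= properE subF //.
    by apply/negP=> /subsetP/(_ y yF); rewrite in_setU1 (negPf ys) eq_sym (negPf zy).
  have linkE x : (x \in link Y' s) =
      (x \notin s) && (if x == v then s \proper F else (x |: s \in Y) && (x |: s != F)).
    rewrite inE Y'E !inE (negPf vs) orbF eq_sym; case: eqVneq => // ->.
    by rewrite setU1K.
  have [/properP[sF [y yF ys]]|nsF] := boolP (s \proper F); last first.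
    rewrite (_ : link Y' s = link Y s) ?stuckY //; apply/setP=> x.
    rewrite linkE inE (negPf nsF); case: eqVneq => [->|xv].
      by rewrite nvY // !inE eqxx.
    case: (boolP (x \in s)) => //= xs; rewrite andb_idr // => _.
    by apply: contraNneq nsF => <-; apply: proper_setU1.
  have yv : y != v by apply: contraNneq vF => <-.
  have sv : v \in link Y' s.
    by rewrite linkE vs eqxx properE sF; apply/subsetPn; exists y.
  have [yE|yF'] := eqVneq (y |: s) F; last first.
    apply: (two _ y v) => //; rewrite linkE ys (negPf yv) yF' andbT.
    by apply: (complexP _ cY _ _ FY); rewrite subUset sub1set yF.
  (* Here [s] is a ridge of [F]: in its link [v] replaces the lost vertex [y]. *)
  rewrite (_ : #|link Y' s| = #|link Y s|) ?stuckY //.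
  rewrite (cardsD1 v) sv (cardsD1 y (link Y s)) inE ys yE FY; congr (_ + _).
  apply: eq_card => x; rewrite in_setD1 in_setD1 linkE inE.
  have [->|xv] := eqVneq x v; first by rewrite nvY ?andbF // !inE eqxx.
  have [->|xy] := eqVneq x y; first by rewrite yE eqxx !andbF.
  rewrite /=; congr (_ && _); rewrite andb_idr // => _; apply: contraNneq ys => xE.
  have : y \in x |: s by rewrite xE.
  by rewrite in_setU1 eq_sym (negPf xy).
- move=> t; rewrite Y'E; case: ifP => [vt /proper_card|_ /andP[/dimY]//].
  by rewrite cF [in X in _ -> X](cardsD1 v) vt.
- exists (v |: (F :\ u)).
    by rewrite Y'E !inE eqxx setU1K ?properD1 // !inE negb_and vF orbT.
  by rewrite cardsU1 !inE (negPf vF) andbF (cardsD1 u F) uF in cF *.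
move=> x; rewrite !inE Y'E inE; case: eqVneq => [->|xv] /=.
  by rewrite setDv proper0; move=> _; apply/set0Pn; exists u.
move=> xU; rewrite vertY //=.
by apply: contraTneq d0 => xF; rewrite -xF cards1 in cF; case: cF => <-.
Qed.

(** * Soundness of the certificates *)

Section Codes.
Variables (us : seq V) (n : nat).
Hypotheses (uniq_us : uniq us) (size_us : size us = n).
Let U := [set x in us].

Definition code s : bitseq := [seq x \in s | x <- us].

Definition decode (m : bitseq) := [set x in us | nth false m (index x us)].

Lemma size_code s : size (code s) = n.
Proof. by rewrite size_map. Qed.

Lemma decode_sub m : decode m \subset U.
Proof. by apply/subsetP=> x; rewrite !inE => /andP[]. Qed.

Lemma codeK s : s \subset U -> decode (code s) = s.
Proof.
move/subsetP=> sU; apply/setP=> x; rewrite inE.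
have [xus|xus] := boolP (x \in us); last first.
  by apply/esym; apply: contraNF xus => /sU; rewrite inE.
by rewrite (nth_map x) ?index_mem // nth_index.
Qed.

Lemma decodeK m : size m = n -> code (decode m) = m.
Proof.
move=> sm; apply: (@eq_from_nth _ false) => [|i]; rewrite ?size_code // => ltin.
have [x0 _ _] : exists2 x, x \in us & predT x.
  by apply/hasP; rewrite has_predT size_us; case: (n) ltin.
rewrite (nth_map x0) ?size_us // inE mem_nth ?size_us //.
by rewrite index_uniq ?size_us.
Qed.

Lemma count_code s : s \subset U -> count id (code s) = #|s|.
Proof.
move=> /subsetP sU; rewrite count_map -size_filter -(card_uniqP (filter_uniq _ uniq_us)).
by apply: eq_card => x; rewrite mem_filter andb_idr // => /sU; rewrite inE.
Qed.

Lemma code_setU1 x0 s i :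
  i < n -> code (nth x0 us i |: s) = set_nth false (code s) i true.
Proof.
move=> ltin; apply: (@eq_from_nth _ false) => [|j].
  by rewrite size_set_nth !size_code (maxn_idPr _).
rewrite size_code => ltjn; rewrite nth_set_nth /= !(nth_map x0) ?size_us // !inE.
by rewrite nth_uniq ?size_us //; case: eqP.
Qed.

Definition realize (C : seq bitseq) := [set s in powerset U | code s \in C].

Lemma realize_bitseqs : realize (bitseqs n) = powerset U.
Proof. by apply/setP=> s; rewrite !inE mem_bitseqs size_code eqxx andbT. Qed.

Lemma card_code_link C s : s \subset U -> #|link (realize C) s| = size (code_link C (code s)).
Proof.
move=> sU; have linkU x : x \in link (realize C) s -> x \in us.
  rewrite !inE => /and3P[_ /subsetP/(_ x) + _].
  by rewrite !inE eqxx; apply.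
have -> : #|link (realize C) s| = count (mem (link (realize C) s)) us.
  rewrite -size_filter -(card_uniqP (filter_uniq _ uniq_us)).
  by apply: eq_card => x; rewrite mem_filter andb_idr // => /linkU.
case us_eq : us => [|x0 us0]; first by rewrite /code_link size_code -size_us us_eq.
rewrite -us_eq -{1}(mkseq_nth x0 us) size_us count_map /code_link size_code size_filter.
apply: eq_in_count => i; rewrite mem_iota add0n => /= ltin.
rewrite !inE -(code_setU1 x0) // (nth_map x0) ?size_us //; congr (_ && _).
by rewrite subUset sub1set sU andbT inE mem_nth ?size_us.
Qed.

Lemma realize_link1 C s i :
    simplicial_complex (realize C) -> s \subset U -> s != set0 ->
    code_link C (code s) = [:: i] ->
  cstep (realize C)
    (realize [seq m <- C | m \notin [:: code s; set_nth false (code s) i true]]).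
Proof.
move=> cC sU s0 cl; have l1 : #|link (realize C) s| = 1 by rewrite card_code_link // cl.
have : i \in code_link C (code s) by rewrite cl mem_head.
rewrite mem_filter mem_iota add0n size_code => /andP[/andP[si siC] /= ltin].
have [x0 _ _] : exists2 x, x \in us & predT x.
  by apply/hasP; rewrite has_predT size_us; case: (n) ltin.
rewrite -(code_setU1 x0) // in siC *; set x := nth x0 _ i in siC *.
have xU : x \in U by rewrite inE mem_nth ?size_us.
have xsU : x |: s \subset U by rewrite subUset sub1set xU.
have xs : x \notin s by rewrite (nth_map x0) ?size_us in si.
have xsC : x |: s \in realize C by rewrite !inE xsU.
apply: elementary_cstep => //; apply/existsP; exists s; apply/existsP; exists (x |: s).
rewrite link_free_face // xsC proper_setU1 //=; apply/eqP/setP=> t; rewrite !inE.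
rewrite mem_filter !inE; case: (boolP (t \subset U)) => tU /=; last by rewrite andbF.
have codeE (r : {set V}) : r \subset U -> (code t == code r) = (t == r).
  by move=> rU; apply/eqP/eqP=> [tr|->//]; rewrite -(codeK tU) tr codeK.
by rewrite !codeE.
Qed.

Lemma collapse_alongP C ms :
  simplicial_complex (realize C) -> collapses (realize C) (realize (collapse_along n C ms)).
Proof.
elim: ms C => [|m ms IH] C cC /=; first exact: collapses_refl.
case: (boolP (has id m)) => [m1|_]; last exact: collapses_refl.
case: eqP => [sm|_]; last exact: collapses_refl.
case cl : (code_link C m) => [|i [|]]; try exact: collapses_refl.
have sE := decodeK sm.
have s0 : decode m != set0.
  apply: contraTneq m1 => s0; rewrite -sE s0 has_map -all_predC.
  by apply/allP=> x _ /=; rewrite inE.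
have st : cstep (realize C) (realize [seq w <- C | w \notin [:: m; set_nth false m i true]]).
  by rewrite -[in X in cstep _ X]sE; apply: realize_link1; rewrite ?decode_sub ?sE.
by apply: (collapses_step st); apply: IH; case: st.
Qed.

Lemma sticks_checkP ms d : sticks_check n ms d -> sticks_at U d.
Proof.
case/and4P=> /allP stuckC /allP dimC /hasP[m mC /andP[/eqP sm cm]] /allP vertC.
exists (realize (collapse_along n (bitseqs n) ms)); split.
- rewrite -{1}realize_bitseqs; apply: collapse_alongP.
  by rewrite realize_bitseqs powerset_complex.
- move=> s s0; have [sU|sU] := boolP (s \subset U).
    rewrite card_code_link //; have := stuckC (code s); rewrite mem_bitseqs size_code eqxx.
    move/(_ isT)/implyP; apply; have [x xs] := set0Pn _ s0.
    apply/hasP; exists true => //; apply/mapP; exists x => //.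
    by rewrite -[_ \in us]in_set (subsetP sU).
  rewrite (_ : link _ _ = set0) ?cards0 //; apply/setP=> x; rewrite !inE.
  by apply: contraNF sU => /and3P[_ /subUsetP[]].
- by move=> t; rewrite !inE => /andP[tU /dimC]; rewrite count_code.
- exists (decode m); first by rewrite inE powersetE decode_sub decodeK.
  by rewrite -count_code ?decode_sub // decodeK //; apply/eqP.
move=> x; rewrite inE => xus; have ltin : index x us < n by rewrite -size_us index_mem.
have := vertC (index x us); rewrite mem_iota ltin => /(_ isT) xC.
rewrite inE powersetE sub1set inE xus /=; apply: etrans xC; congr (_ \in collapse_along _ _ _).
rewrite -[[set x]]setU0 -{1}(nth_index x xus) code_setU1 //; congr set_nth.
apply: (@eq_from_nth _ false) => [|i]; rewrite size_code ?size_nseq // => lti.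
by rewrite nth_nseq lti (nth_map x) ?size_us // inE.
Qed.

End Codes.
End Collapses.

(** * The eight-vertex examples and the induction on the number of vertices *)

Fixpoint bits k m : bitseq := if k is k'.+1 then odd m :: bits k' m./2 else [::].

(* Found by computer: local search for F_2-acyclic families of facets without free
   ridges, followed by a random search for a reversed collapse.  The binary digits
   of each number, lowest first, encode the free face to be removed. *)
Definition collapse_8_2 : seq nat :=
  [:: 191; 190; 63; 183; 95; 187; 189; 235; 188; 185; 59; 91; 107; 233; 62;
      182; 186; 110; 79; 217; 242; 244; 47; 167; 109; 218; 103; 213; 31; 58;
      105; 57; 75; 90; 46; 78; 45; 201; 184; 216; 204; 15; 30; 232; 141;
      180; 166; 228; 226; 240; 39; 154; 177; 149; 99; 108; 209; 83; 54; 43;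
      53; 197; 150; 77; 26; 73; 11; 76; 200; 88; 41; 56; 44; 14; 138; 224;
      137; 164; 193; 176; 162; 35; 133; 145; 49; 67; 7; 22; 50; 81; 146; 37;
      208; 84; 100; 98; 21; 134; 28].

Definition collapse_8_3 : seq nat :=
  [:: 239; 231; 111; 246; 237; 123; 175; 95; 103; 118; 94; 229; 230; 109;
      174; 91; 115; 173; 244; 211; 122; 61; 121; 59; 155; 171; 182; 199;
      220; 45; 57; 228; 101; 116; 120; 172; 166; 114; 39; 184; 178; 27; 83;
      54; 86; 30; 147; 154; 198; 135; 139; 202; 226; 169; 99; 75; 156; 225;
      212; 177; 209; 78; 89; 141].

Definition collapse_8_4 : seq nat :=
  [:: 239; 237; 245; 238; 189; 249; 119; 215; 181; 117; 233; 151; 173; 87;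
      121; 143; 91; 234; 206; 155; 186; 188; 124; 110; 214; 47; 103; 220;
      227].

Lemma sticks_at_8 (V : finType) (U : {set V}) d :
  #|U| = 8 -> 2 <= d <= 4 -> sticks_at U d.
Proof.
move=> U8 d24; have -> : U = [set x in enum U] by apply/setP=> x; rewrite inE mem_enum.
have sz8 : size (enum U) = 8 by rewrite -cardE.
case: d d24 => [|[|[|[|[|d]]]]] // _.
- by apply: (sticks_checkP (enum_uniq U) sz8 (ms := map (bits 8) collapse_8_2)); vm_compute.
- by apply: (sticks_checkP (enum_uniq U) sz8 (ms := map (bits 8) collapse_8_3)); vm_compute.
- by apply: (sticks_checkP (enum_uniq U) sz8 (ms := map (bits 8) collapse_8_4)); vm_compute.
Qed.

Lemma sticks_at_ge8 (V : finType) n d (U : {set V}) :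
  #|U| = n -> 8 <= n -> 2 <= d -> d + 4 <= n -> sticks_at U d.
Proof.
move=> cU n8 d2 dn; elim: n d n8 U cU d2 dn => // n IH d n8 U cU d2 dn.
move: n8; rewrite leq_eqVlt => /orP[/eqP n8|]; last rewrite ltnS => n8.
  by apply: sticks_at_8; rewrite ?cU ?d2 //= -(leq_add2r 4) (leq_trans dn) // -n8.
have [v vU] : exists v, v \in U by apply/card_gt0P; rewrite cU.
have cU' : #|U :\ v| = n by rewrite (cardsD1 v) vU in cU; case: cU.
have vU' : v \notin U :\ v by rewrite !inE eqxx.
rewrite -(setD1K vU); have [dn'|dn'] := leqP (d + 4) n.
  by apply: facet_subdivision => //; [apply: ltnW|apply: IH].
have dE : d + 4 = n.+1 by apply/eqP; rewrite eqn_leq dn.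
case: d d2 dE {dn dn'} => // d d2 [dE]; apply: one_point_suspension => //.
  by rewrite cU'; apply: leq_trans n8.
(* Here [d + 4 = n] with [n >= 8], so the bound [2 <= d] survives the decrease. *)
by apply: IH => //; lia.
Qed.

Lemma complex_dimP (V : finType) (Y : {set {set V}}) (d : nat) :
  complex_dim Y = d%:Z%R <->
  (forall t, t \in Y -> #|t| <= d.+1) /\ (exists2 F, F \in Y & #|F| = d.+1).
Proof.
rewrite /complex_dim /face_dim; split=> [dE|[dimY [F FY cF]]].
  have dimY t : t \in Y -> #|t| <= d.+1.
    move=> tY; have := le_bigmax_cond (-1)%R (fun s : {set V} => #|s|%:Z - 1)%R tY.
    by rewrite dE; lia.
  split=> //; suff /exists_inP[F FY /eqP cF] : [exists F in Y, #|F| == d.+1] by exists F.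
  apply: contraT => /exists_inPn noF.
  (* The initial value -1 of the maximum also respects the bound [d - 1]. *)
  have : (d%:Z <= d%:Z - 1)%R; last by lia.
  rewrite -{1}dE; apply: bigmax_le => [|t tY]; first by lia.
  by have := dimY t tY; have := noF t tY; lia.
apply/eqP; rewrite eq_le; apply/andP; split.
  by apply: bigmax_le => [|t /dimY]; lia.
have := le_bigmax_cond (-1)%R (fun s : {set V} => #|s|%:Z - 1)%R FY.
by rewrite cF; apply: le_trans; lia.
Qed.

Lemma sticks_at_full n d :
  sticks_at [set: 'I_n] d ->
  exists (Xs : seq {set {set 'I_n}}) (Y : {set {set 'I_n}}),
    [/\ gets_stuck_at (full_simplex 'I_n) Xs Y, simplicial_complex Y,
        complex_dim Y = d%:Z%R & forall v : 'I_n, [set v] \in Y].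
Proof.
case=> Y [colY stuckY dimY exF vertY].
have cY := collapses_complex colY (powerset_complex _).
have [Xs pXs lXs] := collapses_seq colY; exists Xs, Y.
have fE : full_simplex 'I_n = powerset setT.
  by apply/setP=> s; rewrite !inE subsetT.
split=> //; last by move=> v; apply: vertY.
  by rewrite fE; split=> //; apply/stuckP.
by apply/complex_dimP.
Qed.

(** * The homological obstruction *)

Section Chains.
Variable V : finType.
Implicit Types (A B X Y b c : {set {set V}}) (e s t : {set V}) (v x y : V).

(* A chain over F_2 is a set of faces, and may mix dimensions. *)
Definition bdry c e : bool := \big[addb/false]_(y | y \notin e) (y |: e \in c).
(** The empty face is among the [e], so the homology is reduced. *)
Definition cycle c := forall e, bdry c e = false.
Definition symdiff A b := (A :\: b) :|: (b :\: A).

Lemma in_symdiff A b t : (t \in symdiff A b) = (t \in A) (+) (t \in b).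
Proof. by rewrite !inE; case: (t \in A); case: (t \in b). Qed.

Lemma bdry_symdiff A b e : bdry (symdiff A b) e = bdry A e (+) bdry b e.
Proof. by rewrite /bdry -big_split; apply: eq_bigr => y _; rewrite in_symdiff. Qed.

Lemma addb_card (T : finType) (P Q : pred T) :
  \big[addb/false]_(y | P y) Q y = odd #|[set y | P y & Q y]|.
Proof.
rewrite -sum1dep_card (big_morph odd oddD (erefl : odd 0 = false)).
by rewrite big_mkcondr; apply: eq_bigr => y _; case: (Q y).
Qed.

Lemma bdry_link c e : bdry c e = odd #|link c e|.
Proof. exact: addb_card. Qed.

Lemma bdry_coface c e : bdry c e -> exists2 y, y \notin e & y |: e \in c.
Proof.
rewrite bdry_link => odd_c; have /card_gt0P[y] := odd_gt0 odd_c.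
by rewrite inE => /andP[]; exists y.
Qed.

(* Each face with two vertices more than [e] is counted once for each order of these. *)
Lemma bdry_bdry b e : \big[addb/false]_(y | y \notin e) bdry b (y |: e) = false.
Proof.
(* The ranks order the vertices and split each double sum into two halves, which exchanging the sums
   identifies. *)
pose F y z := (enum_rank y < enum_rank z)%N && (z |: (y |: e) \in b).
have -> : \big[addb/false]_(y | y \notin e) bdry b (y |: e) =
  \big[addb/false]_(y | y \notin e)
    \big[addb/false]_(z | z \notin e) (F y z (+) F z y).
  apply: eq_bigr => y ye; rewrite /bdry big_mkcond [RHS]big_mkcond; apply: eq_bigr => z _.
  rewrite /F !inE negb_or (setUCA [set y]).
  case: (z \in e); rewrite ?andbF ?andbT //= -(inj_eq enum_rank_inj).
  by rewrite -val_eqE /=; case: ltngtP; rewrite ?addbF.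
under eq_bigr do rewrite big_split.
rewrite big_split /=.
have <- : \big[addb/false]_(y | y \notin e) \big[addb/false]_(z | z \notin e) F y z =
          \big[addb/false]_(y | y \notin e) \big[addb/false]_(z | z \notin e) F z y.
  exact: exchange_big.
exact: addbb.
Qed.

Definition acyclic X := forall c, c \subset X -> cycle c ->
  exists2 b : {set {set V}}, b \subset X & forall e, bdry b e = (e \in c).

(** If [v] is not in [e], only [v |: e] contributes. Otherwise the terms are those of
    [bdry c (e :\ v)], which vanishes, except the one for [e] itself. *)
Lemma bdry_cone v c e : cycle c ->
  bdry [set t : {set V} | (v \in t) && (t :\ v \in c)] e = (e \in c).
Proof.
move=> cyc; have [ve|ve] := boolP (v \in e); last first.
  rewrite /bdry (bigD1 v) //= inE !inE eqxx /= setU1K // big1 ?addbF // => y.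
  by case/andP=> _ yv; rewrite !inE eq_sym (negPf yv) (negPf ve).
have := cyc (e :\ v); rewrite /bdry (bigD1 v) /= ?inE ?eqxx // setD1K //.
move/(congr1 (addb (e \in c))); rewrite addbA addbb addFb addbF => <-.
apply: eq_big => [y|y ye].
  by rewrite !inE negb_and negbK; case: eqVneq => [->|]; rewrite ?ve ?andbT ?andbF.
rewrite !inE ve orbT /= setU1D1 //.
by apply: contraNneq ye => ->.
Qed.

Lemma acyclic_full v : acyclic [set: {set V}].
Proof.
by move=> c _ cyc; exists [set t : {set V} | (v \in t) && (t :\ v \in c)] => // e;
   apply: bdry_cone.
Qed.

(** A chain [b] of [X] bounded by [c] avoids [x |: s], the only coface of [s], because [s] is not in
    [c]. If [b] contains [s], adding the boundary of [x |: s] removes it and leaves the boundary of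
    [b] unchanged. *)
Lemma acyclic_step X X' : cstep X X' -> acyclic X -> acyclic X'.
Proof.
case=> /complexP cX /complexP cX' [s [x [s0 xs sX' xsX' XE]]] acX c cX'c cyc.
have X'X : X' \subset X by rewrite XE subsetUl.
have [b bX bE] := acX c (subset_trans cX'c X'X) cyc.
have xsX : x |: s \in X by rewrite XE !inE eqxx !orbT.
have bd b' : b' \subset X -> bdry b' s = (x |: s \in b').
  move=> b'X; rewrite /bdry (bigD1 x) //= big1 ?addbF // => y /andP[ys yx].
  apply: contraTF isT => /(subsetP b'X); rewrite XE !inE.
  case/orP=> [/cX' h|]; first by rewrite h ?subsetUr in sX'.
  case/orP=> /eqP/setP/(_ y); rewrite !inE eqxx (negPf ys) //= orbF.
  by rewrite (negPf yx).
have xsb : x |: s \notin b.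
  by rewrite -bd // bE; apply: contra sX'; apply: (subsetP cX'c).
have [sb|sb] := boolP (s \in b); last first.
  exists b => //; apply/subsetP=> t tb; have := subsetP bX t tb.
  rewrite XE !inE => /orP[//|/orP[]/eqP tE]; first by rewrite -tE tb in sb.
  by rewrite -tE tb in xsb.
pose g := [set t : {set V} | bdry [set x |: s] t].
have gX : g \subset X.
  apply/subsetP=> t; rewrite inE => /bdry_coface[y _]; rewrite inE => /eqP tE.
  by apply: cX xsX _; rewrite -tE subsetUr.
have gcyc : cycle g.
  by move=> e; rewrite -(bdry_bdry [set x |: s] e); apply: eq_bigr => y _; rewrite inE.
have sg : s \in g.
  by rewrite inE bd ?inE ?eqxx // sub1set.
have xsg : x |: s \notin g.
  rewrite inE; apply/negP=> /bdry_coface[y ye]; rewrite inE => /eqP/setP/(_ y).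
  by rewrite (negPf ye) !inE eqxx.
exists (symdiff b g); last by move=> e; rewrite bdry_symdiff bE gcyc addbF.
have bgX t : t \in symdiff b g -> t \in X.
  by rewrite in_symdiff; case: (boolP (t \in b)) => [/(subsetP bX)|_ /(subsetP gX)].
apply/subsetP=> t tbg; have := bgX t tbg; rewrite XE !inE => /orP[//|/orP[]/eqP tE].
  by rewrite tE in_symdiff sb sg in tbg.
by rewrite tE in_symdiff (negPf xsb) (negPf xsg) in tbg.
Qed.

Lemma collapses_acyclic X Y : collapses X Y -> acyclic X -> acyclic Y.
Proof. by elim=> // {}X X' {}Y st _ IH /(acyclic_step st). Qed.

Definition no_cycle (B : {set {set V}}) := forall c, c \subset B -> cycle c -> c = set0.

(** A cycle of top-dimensional faces would have to bound, but [Y] has no larger faces. *)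
Lemma no_top_cycle v Y k :
  collapses setT Y -> (forall t, t \in Y -> #|t| <= k) ->
  no_cycle [set t in Y | #|t| == k].
Proof.
move=> colY dimY c /subsetP cY cyc.
have cY' : c \subset Y by apply/subsetP=> t /cY; rewrite inE => /andP[].
have [b bY bE] := collapses_acyclic colY (acyclic_full v) cY' cyc.
apply/setP=> t; rewrite inE; apply/negP=> tc.
have := bE t; rewrite tc => /bdry_coface[y yt /(subsetP bY)/dimY].
have := cY t tc; rewrite inE => /andP[_ /eqP ct].
by rewrite cardsU1 yt ct ltnn.
Qed.

Lemma setU1C x s : x |: ~: s = ~: (s :\ x).
Proof. by apply/setP=> y; rewrite !inE negb_and negbK. Qed.

(** * Families of facets without free ridges *)

Definition ridges B := [set e | link B e != set0].

Definition uniform k (B : {set {set V}}) := forall t, t \in B -> #|t| = k.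

Definition ridge_stuck B := forall e, #|link B e| != 1.

Lemma link_card k B e x : uniform k.+1 B -> x \in link B e -> #|e| = k.
Proof.
move=> uB; rewrite inE => /andP[xe /uB].
by rewrite cardsU1 xe => -[].
Qed.

Lemma uniform_sub k B c : c \subset B -> uniform k B -> uniform k c.
Proof. by move=> /subsetP cB uB t /cB/uB. Qed.

Lemma uniform_cycle k c :
  uniform k.+1 c -> (forall e, #|e| = k -> ~~ bdry c e) -> cycle c.
Proof.
move=> uc nc e; apply/negbTE; have [/nc//|] := eqVneq #|e| k.
apply: contra => /bdry_coface[y ye yec]; apply/eqP.
by apply: (@link_card k c e y); rewrite // inE ye.
Qed.

(** At most two vertices lie outside a ridge, so every degree is 0 or 2 and [B] is a cycle. *)
Lemma stuck_codim2 k B :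
  uniform k.+1 B -> ridge_stuck B -> no_cycle B -> #|V| <= k.+2 -> B = set0.
Proof.
move=> uB sB nB leV; apply: nB => //; apply: (uniform_cycle uB) => e ek.
rewrite bdry_link; have: #|link B e| <= 2.
  apply: (@leq_trans #|~: e|); last by rewrite cardsCs setCK ek leq_subLR; lia.
  by apply/subset_leq_card/subsetP=> x; rewrite !inE => /andP[].
by have := sB e; case: #|link B e| => [|[|[]]].
Qed.

(* The graph on [V] with edges the complements of members of [B] has no triple with
   exactly one edge, so non-adjacency is an equivalence; [A] is one of its classes,
   and the cut between [A] and its complement is a cycle. *)
Lemma stuck_codim3 k B :
  uniform k.+1 B -> ridge_stuck B -> no_cycle B -> #|V| = k.+3 -> B = set0.
Proof.
move=> uB sB nB cV; apply/eqP/set0Pn=> -[t0 t0B].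
have cC (t : {set V}) : #|t| + #|~: t| = k.+3 by rewrite cardsC.
have [a at0] : exists a, a \in ~: t0.
  by apply/card_gt0P; have := cC t0; rewrite (uB _ t0B); lia.
pose adj x := ~: [set a; x] \in B.
pose A := [set x | (x == a) || ~~ adj x].
have cutB t : #|t| = k.+1 -> odd #|~: t :&: A| -> t \in B.
  move=> ct; have c2 : #|~: t| = 2 by have := cC t; rewrite ct; lia.
  have := cardsID A (~: t); rewrite c2 => cID oA.
  have /cards1P[x xE] : #|~: t :&: A| == 1 by case: #|_| oA cID => [|[|[|]]] //=; lia.
  have /cards1P[y yE] : #|~: t :\: A| == 1 by apply/eqP; rewrite xE cards1 in cID; lia.
  have tE : t = ~: [set x; y] by rewrite -[t]setCK -(setID (~: t) A) xE yE.
  have xA : x \in A by have := set11 x; rewrite -xE inE => /andP[].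
  have /setDP[_] : y \in ~: t :\: A by rewrite yE set11.
  rewrite !inE negb_or negbK => /andP[ya ady].
  have [xa|xa] := eqVneq x a; first by rewrite tE xa.
  have nadx : ~~ adj x by move: xA; rewrite inE (negPf xa).
  have xy : x != y.
    by apply: contraTneq xA => ->; rewrite inE negb_or ya negbK.
  (* Otherwise the triple [a], [x], [y] would contain the single edge [a y]. *)
  apply: contraT => tB; have := sB (~: [set a; x; y]).
  rewrite (_ : link B _ = [set x]) ?cards1 //; apply/setP=> z.
  rewrite in_set1 inE setU1C inE negbK !in_setU !in_set1.
  have [->|zx] := eqVneq z x.
    have -> : [set a; x; y] :\ x = [set a; y]; last by rewrite -/(adj y) ady orbT.
    apply/setP=> w; rewrite !inE.
    by case: (eqVneq w x) => [->|_]; rewrite ?(negPf xa) ?(negPf xy) ?orbF.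
  rewrite orbF; have [->|za] := eqVneq z a.
    have -> : [set a; x; y] :\ a = [set x; y]; last by rewrite -tE (negPf tB).
    apply/setP=> w.
    rewrite !inE; case: (eqVneq w a) => [->|_] //=.
    by rewrite eq_sym (negPf xa) eq_sym (negPf ya).
  have [->|//] := eqVneq z y.
  have -> : [set a; x; y] :\ y = [set a; x]; last by rewrite -/(adj x) (negPf nadx).
  apply/setP=> w.
  rewrite !inE; case: (eqVneq w y) => [->|_]; rewrite ?orbF //=.
  by rewrite (negPf ya) eq_sym (negPf xy).
pose c := [set t in B | odd #|~: t :&: A|].
have cB : c \subset B by apply/subsetP=> t; rewrite inE => /andP[].
have cE t : #|t| = k.+1 -> (t \in c) = odd #|~: t :&: A|.
  by move=> ct; rewrite inE andb_idl //; apply: cutB.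
suff : c = set0.
  (* The edge [~: t0] joins [a] to a neighbour, so it crosses the cut. *)
  move/setP/(_ t0); rewrite (cE t0 (uB t0 t0B)) in_set0 => /negP[].
  have [b bt0 ab] : exists2 b, ~: t0 = [set a; b] & b != a.
    have : #|~: t0 :\ a| = 1 by have := cC t0; rewrite (uB _ t0B) (cardsD1 a) at0; lia.
    move=> /eqP/cards1P[b bE]; exists b; first by rewrite -bE setD1K.
    by have := set11 b; rewrite -bE !inE => /andP[].
  rewrite bt0 (_ : _ :&: _ = [set a]) ?cards1 //; apply/setP=> w; rewrite !inE.
  have [->|wa] := eqVneq w a; first by rewrite ?eqxx.
  by case: eqVneq => //= ->; rewrite /adj -bt0 setCK t0B.
apply: nB => //; apply: (uniform_cycle (uniform_sub cB uB)) => e ek.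
have c3 : #|~: e| = 3 by have := cC e; rewrite ek; lia.
(* A triple has evenly many pairs crossing the cut: the sum is three times the parity of its points
   in [A], plus that parity. *)
have -> : bdry c e = \big[addb/false]_(y in ~: e) (odd #|~: e :&: A| (+) (y \in A)).
  apply: eq_big => [y|y ye]; first by rewrite inE.
  rewrite cE; last by rewrite cardsU1 ye ek.
  have -> : ~: (y |: e) :&: A = (~: e :&: A) :\ y.
    by apply/setP=> w; rewrite !inE negb_or andbA.
  by rewrite [in RHS](cardsD1 y) oddD inE in_setC ye oddb addbC addbA addbb.
rewrite big_split /= big_const c3 addb_card.
rewrite (_ : [set _ | _] = ~: e :&: A); last by apply/setP=> w; rewrite !inE.
by case: (odd _).
Qed.

(* If [bdry c] vanishes off [v], then it vanishes everywhere, since its own boundary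
   does.  So the subsets of [B] have
   distinct boundaries off [v]. *)
Lemma card_le_ridges k B v :
  uniform k.+1 B -> no_cycle B ->
  #|B| <= #|[set e in ridges B | v \notin e]|.
Proof.
move=> uB nB; rewrite -(leq_exp2l _ _ (ltnSn 1)) -!card_powerset.
pose f c := [set e : {set V} | (v \notin e) && bdry c e].
have f_inj : {in powerset B &, injective f}.
  move=> c1 c2; rewrite !inE => c1B c2B /setP f12.
  have cB : symdiff c1 c2 \subset B.
    by rewrite subUset !(subset_trans (subsetDl _ _)).
  have cyc_v e : v \notin e -> bdry (symdiff c1 c2) e = false.
    by move=> ve; have := f12 e; rewrite !inE ve bdry_symdiff => /= ->; rewrite addbb.
  have /(nB _ cB) c0 : cycle (symdiff c1 c2).
    move=> e; have [ve|/cyc_v//] := boolP (v \in e).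
    have := bdry_bdry (symdiff c1 c2) (e :\ v).
    rewrite (bigD1 v) /= ?inE ?eqxx // setD1K // big1 ?addbF // => y /andP[_ yv].
    by rewrite cyc_v // !inE eqxx eq_sym (negPf yv).
  by apply/setP=> t; have := in_symdiff c1 c2 t; rewrite c0 inE; do 2 case: (_ \in _).
rewrite -(card_in_imset f_inj); apply/subset_leq_card/subsetP=> _ /imsetP[c cB ->].
rewrite inE; apply/subsetP=> e; rewrite !inE => /andP[-> /bdry_coface[y ye yec]].
rewrite andbT; apply/set0Pn; exists y; rewrite inE ye (subsetP _ _ yec) //.
by rewrite inE in cB.
Qed.

(** Both sides count the pairs of a member of [B] and one of its vertices; deleting the vertex gives
    the ridge. *)
Lemma sum_link k B : uniform k B -> \sum_(e : {set V}) #|link B e| = #|B| * k.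
Proof.
move=> uB; transitivity (\sum_(e : {set V}) \sum_y ((y \notin e) && (y |: e \in B) : nat)).
  by apply: eq_bigr => e _; rewrite -sum1dep_card big_mkcond; apply: eq_bigr => y _; case: ifP.
rewrite exchange_big /=; transitivity (\sum_y \sum_(t in B) (y \in t)).
  apply: eq_bigr => y _; rewrite (big_mkcond (mem B)) /=.
  rewrite (bigID (fun e : {set V} => y \in e)) /= big1 ?add0n => [|e ->//].
  rewrite [RHS](bigID (fun t : {set V} => y \in t)) /= [X in _ = _ + X]big1 ?addn0; last first.
    by move=> t /negPf->; case: ifP.
  rewrite (reindex_onto (fun t => t :\ y) (fun e => y |: e)) /=; last by move=> e; apply: setU1K.
  apply: eq_big => [t|t /andP[yt /eqP tE]].
    rewrite !inE eqxx /=; apply/eqP/idP=> [<-|]; first by rewrite !inE eqxx.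
    exact: setD1K.
  by rewrite tE yt /= -tE !inE eqxx /=; case: ifP.
rewrite exchange_big /= -sum_nat_const; apply: eq_bigr => t /uB <-.
by rewrite -sum1_card [RHS]big_mkcond; apply: eq_bigr => y _; case: ifP.
Qed.

(** Every ridge has degree at least 2, and at least 3 if its degree is odd; equality means that all
    these degrees are 2 or 3. *)
Lemma ridge_count k B : uniform k B -> ridge_stuck B ->
  #|ridges B| * 2 + #|[set e | bdry B e]| <= #|B| * k
    ?= iff [forall e, (e \in ridges B) * 2 + bdry B e == #|link B e|].
Proof.
move=> uB sB; rewrite -(sum_link uB) -sum1_card -sum1dep_card big_distrl /=.
rewrite big_mkcond [X in _ + X]big_mkcond -big_split /=.
have -> : \sum_(e : {set V})
    ((if e \in ridges B then 1 * 2 else 0) + (if bdry B e then 1 else 0)) =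
    \sum_e ((e \in ridges B) * 2 + bdry B e).
  by apply: eq_bigr => e _; do 2 case: ifP.
apply: leqif_sum => e _; apply: leqif_eq; rewrite bdry_link inE -cards_eq0.
by have := sB e; case: #|link B e| => [|[|[|m]]] //= _; case: odd.
Qed.

(** Degrees at least 2 give a graph at least as many edges as non-isolated vertices; without cycles
    it has fewer. *)
Lemma stuck_dim1 B : uniform 2 B -> ridge_stuck B -> no_cycle B -> B = set0.
Proof.
move=> uB sB nB; apply/eqP/set0Pn=> -[t tB].
have [v vt] : exists v, v \in t by apply/card_gt0P; rewrite (uB _ tB).
have tv : v \in link B (t :\ v) by rewrite !inE eqxx setD1K.
have : #|t :\ v| = 1 := link_card uB tv.
move/eqP/cards1P=> [w wE].
have := card_le_ridges w uB nB; have [+ _] := ridge_count uB sB.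
have -> : [set e in ridges B | w \notin e] =
          ridges B :\ [set w].
  apply/setP=> e; rewrite !inE andbC.
  apply: andb_id2r => /set0Pn[x /(link_card uB)/eqP/cards1P[y ->]].
  by rewrite inE (inj_eq set1_inj) eq_sym.
have : [set w] \in ridges B.
  by rewrite -wE inE; apply/set0Pn; exists v.
by move=> wR; rewrite (cardsD1 [set w] (ridges B)) wR; lia.
Qed.

(** * Dimension 2 on at most seven vertices *)

(** The ridges of odd degree form a cycle, so an even number of them contain [e] as a ridge. *)
Lemma bdry_other B e x : x \notin e -> bdry B (x |: e) ->
  exists2 y, y \notin x |: e & bdry B (y |: e).
Proof.
move=> xe Bxe; have := bdry_bdry B e; rewrite (bigD1 x) //= Bxe.
move/(congr1 (addb true)); rewrite addbA addbb addFb addb_card => odd_c.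
have /card_gt0P[y] := odd_gt0 (etrans odd_c (erefl true)).
rewrite inE => /andP[/andP[ye yx] By]; exists y => //.
by rewrite !inE negb_or yx.
Qed.

Lemma bdry_simplex t e : bdry [set t] e = (e \subset t) && (#|t| == #|e|.+1).
Proof.
apply/idP/andP=> [/bdry_coface[y ye /set1P <-]|[et /eqP ct]].
  by rewrite subsetUr cardsU1 ye.
have /eqP/cards1P[y yE] : #|t :\: e| = 1 by rewrite cardsD (setIidPr et); lia.
rewrite bdry_link (_ : link _ _ = [set y]) ?cards1 //; rewrite -yE.
apply/setP=> z; rewrite !inE; case: (boolP (z \in e)) => //= ze.
apply/eqP/idP=> [<-|zt]; first by rewrite !inE eqxx.
by apply/eqP; rewrite eqEcard subUset sub1set zt et cardsU1 ze ct add1n leqnn.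
Qed.

(** The first two inequalities give [nO <= nD * (n - 6) / n] over the rationals. This excludes
    [n <= 6]; for [n = 7] it reads [nO <= nD / 7 <= 3], so all bounds are attained. *)
Lemma dim2_arith n nD nO nB : 0 < n <= 7 -> nD * 2 + nO <= nB * 3 ->
    n * nB <= nD * (n - 2) -> nD <= 'C(n, 2) -> 2 < nO ->
  [/\ n = 7, nD = 21, nB = 15 & nO = 3].
Proof.
rewrite bin2; case: n => [//|[|[|[|[|[|[|[|//]]]]]]]] _ /= *; split; lia.
Qed.

Lemma stuck_dim2_count B (n := #|V|) (D := ridges B)
    (O := [set e | bdry B e]) :
  uniform 3 B -> ridge_stuck B -> no_cycle B -> n <= 7 ->
  #|O| < 3 \/
  [/\ n = 7, #|B| = 15, #|O| = 3 & forall e, bdry B e -> #|link B e| = 3].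
Proof.
move=> uB sB nB n7.
have rc : #|D| * 2 + #|O| <= #|B| * 3 := (ridge_count uB sB).1.
(* Sum [card_le_ridges] over all [v]: a ridge has two vertices and is counted for each of the
   others. *)
have nD : n * #|B| <= #|D| * (n - 2).
  rewrite /n -cardsT -sum_nat_const.
  apply: (@leq_trans (\sum_(v in [set: V]) #|[set e in ridges B | v \notin e]|)).
    by apply: leq_sum => v _; exact: (card_le_ridges v uB nB).
  rewrite -sum_nat_const; under eq_bigr do rewrite -sum1dep_card big_mkcondr.
  rewrite exchange_big /=; apply: leq_sum => e; rewrite inE => /set0Pn[x /(link_card uB) e2].
  rewrite -big_mkcondr sum1dep_card cardsT -e2 -(cardsC e) addKn.
  by apply/subset_leq_card/subsetP=> v; rewrite !inE.
have D2 : #|D| <= 'C(n, 2).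
  rewrite -card_draws; apply/subset_leq_card/subsetP=> e.
  by rewrite !inE => /set0Pn[x /(link_card uB)->].
have [O3|] := leqP 3 #|O|; last by left.
right.
have n0 : 0 < n.
  have /card_gt0P[e] : 0 < #|O| by apply: leq_trans O3.
  by rewrite inE => /bdry_coface[x _ _]; apply/card_gt0P; exists x.
have [n_7 D21 B15 O_3] : [/\ n = 7, #|D| = 21, #|B| = 15 & #|O| = 3].
  by apply: dim2_arith; rewrite ?n0.
(* These values give equality in [ridge_count], so odd degrees equal 3. *)
split=> // e Be; have [_] := ridge_count uB sB.
rewrite -/D -/O D21 B15 O_3 => /esym/forallP/(_ e)/eqP <-.
by rewrite Be inE -cards_eq0; move: Be; rewrite bdry_link; case: #|_|.
Qed.

(* The ridges of odd degree form a cycle with at most three edges, hence they are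
   the edges of a triangle [tau], and [B] plus [tau] is a cycle.  If [tau] is not in [B], counting the nine members of [B] on
   its edges gives a [w] with the other three faces of [w |: tau] in [B], and these
   can be removed from [B] instead. *)
Lemma stuck_dim2 B : uniform 3 B -> ridge_stuck B -> no_cycle B -> #|V| <= 7 -> B = set0.
Proof.
move=> uB sB nB V7; apply: (nB) => // e; have [Be|/negbTE//] := boolP (bdry B e); exfalso.
have [x xe xeB] := bdry_coface Be; have e2 : #|e| = 2.
  by apply: (@link_card _ B e x); rewrite // inE xe.
have /cards2P[a [b [ab eE]]] : #|e| == 2 by rewrite e2.
rewrite {e e2 x xe xeB}eE in Be.
have [c cab Bbc] : exists2 c, c \notin [set a; b] & bdry B [set c; b].
  by apply: bdry_other; rewrite // inE.
have [c' cba Bac] : exists2 c', c' \notin [set b; a] & bdry B [set c'; a].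
  by apply: bdry_other; rewrite 1?setUC // inE eq_sym.
pose O := [set e | bdry B e].
move: cab cba; rewrite !inE !negb_or => /andP[ca cb] /andP[c'b c'a].
have bcE : [set a; b] != [set c; b].
  by apply: contraNneq ca => /setP/(_ a); rewrite !inE eqxx (negPf ab) !orbF eq_sym => <-.
have acE : [set c'; a] \notin [set [set a; b]; [set c; b]].
  rewrite !inE negb_or; apply/andP; split; apply/eqP=> /setP.
    by move/(_ b); rewrite !inE eqxx orbT eq_sym (negPf c'b) eq_sym (negPf ab).
  by move/(_ a); rewrite !inE eqxx orbT eq_sym (negPf ca) (negPf ab).
have sO : [set c'; a] |: [set [set a; b]; [set c; b]] \subset O.
  by rewrite !subUset !sub1set !inE Be Bbc Bac.
have cO : #|[set c'; a] |: [set [set a; b]; [set c; b]]| = 3.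
  by rewrite cardsU1 acE cards2 bcE.
have [|[V_7 B15 O3 deg3]] := stuck_dim2_count uB sB nB V7.
  by rewrite ltnNge -cO subset_leq_card.
have OE : [set c'; a] |: [set [set a; b]; [set c; b]] = O.
  by apply/eqP; rewrite eqEcard sO cO O3.
(* A second odd ridge at [c] must be one of the three known ones, and only [[set c'; a]] is
   possible. *)
have cc' : c = c'.
  have [y] : exists2 y, y \notin [set b; c] & bdry B [set y; c].
    by apply: bdry_other; rewrite 1?setUC // inE eq_sym.
  rewrite !inE negb_or => /andP[yb yc] Byc.
  have : [set y; c] \in O by rewrite inE.
  rewrite -OE !inE => /or3P[] /eqP/setP h.
  - by have := h c; rewrite !inE eqxx orbT (negPf ca) orbF => /esym/eqP.
  - by have := h c; rewrite !inE eqxx orbT (negPf ca) (negPf cb).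
  - by have := h y; rewrite !inE eqxx (negPf yb) (negPf yc).
pose tau := [set a; b; c].
have tau3 : #|tau| = 3.
  by rewrite /tau setUC cardsU1 !inE negb_or ca cb cards2 ab.
pose O' := [set e | bdry [set tau] e].
have OO' : O = O'.
  apply/eqP; rewrite eqEcard; apply/andP; split.
    rewrite -OE -cc' !subUset !sub1set !inE !bdry_simplex tau3 !cards2 ab.
    rewrite ca cb eqxx !andbT !subUset !sub1set !inE !eqxx !orbT //.
  have binE : 'C(#|tau|, 2) = 3 by rewrite tau3.
  rewrite O3 -binE -cards_draws.
  apply/subset_leq_card/subsetP=> t; rewrite !inE bdry_simplex tau3.
  by case/andP=> -> /eqP[<-].
have bdry_tau t : bdry [set tau] t = bdry B t.
  by have /setP/(_ t) := OO'; rewrite !inE.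
pose K0 := symdiff B [set tau].
have K0_cycle : cycle K0 by move=> t; rewrite bdry_symdiff bdry_tau addbb.
have [tauB|tauB] := boolP (tau \in B).
  have K00 : K0 = set0.
    apply: nB => //; apply/subsetP=> t; rewrite in_symdiff inE.
    by case: eqP => [-> //|_]; rewrite addbF.
  have : #|B| <= #|[set tau]|.
    apply/subset_leq_card/subsetP=> t tB; have /setP/(_ t) := K00.
    by rewrite in_symdiff tB !inE; case: eqP.
  by rewrite B15 cards1.
have ctau : #|~: tau| = 4.
  by apply: (@addnI 3); rewrite -tau3 cardsC tau3 V_7.
have linkC t : bdry B t -> #|~: tau :\: link B t| = 1.
  move=> Bt; have : link B t \subset ~: tau.
    apply/subsetP=> x; rewrite !inE => /andP[xt xtB]; apply: contra tauB => xtau.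
    have : bdry [set tau] t by rewrite bdry_tau.
    rewrite bdry_simplex => /andP[ttau /eqP ct].
    suff -> : tau = x |: t by [].
    apply/eqP; rewrite eq_sym eqEcard subUset sub1set ttau cardsU1 xt ct.
    by rewrite !inE xtau add1n leqnn.
  move/setIidPr=> lC; rewrite cardsD lC deg3 //.
  by rewrite ctau.
(* The link of each edge of [tau] omits one of the four vertices outside [tau]; three omissions
   leave some [w]. *)
have [w wtau wO] : exists2 w, w \notin tau & forall t, bdry B t -> w |: t \in B.
  pose M t := ~: tau :\: link B t.
  have [w] : exists w, w \in ~: tau :\: (M [set a; b] :|: M [set c; b] :|: M [set c'; a]).
    apply/card_gt0P; rewrite cardsD subn_gt0.
    rewrite ctau (leq_ltn_trans (subset_leq_card (subsetIr _ _))) //.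
    rewrite (leq_ltn_trans (leq_card_setU _ _).1) // (linkC _ Bac) addn1 !ltnS.
    apply: leq_trans (leq_card_setU _ _).1 _.
    by rewrite /M (linkC _ Be) (linkC _ Bbc).
  rewrite in_setD in_setC => /andP[wM wtau]; exists w => // t Bt.
  have : t \in O by rewrite inE.
  have inM t' : w \notin M t' -> w |: t' \in B.
    by rewrite /M in_setD in_setC wtau andbT negbK inE => /andP[].
  move: wM; rewrite !in_setU !negb_or => /andP[/andP[/inM h1 /inM h2] /inM h3].
  by rewrite -OE in_setU1 in_set2 => /or3P[] /eqP->.
pose sig := w |: tau.
have csig : #|sig| = 4 by rewrite cardsU1 wtau tau3.
pose g := [set t | bdry [set sig] t].
have g_cycle : cycle g.
  by move=> t; rewrite -(bdry_bdry [set sig] t); apply: eq_bigr => y _; rewrite inE.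
have gE t : (t \in g) = (t \subset sig) && (#|t| == 3).
  by rewrite inE bdry_simplex csig eqSS eq_sym.
have K_cycle : cycle (symdiff K0 g).
  by move=> t; rewrite bdry_symdiff K0_cycle g_cycle.
have KB : symdiff K0 g \subset B.
  apply/subsetP=> t; rewrite in_symdiff in_symdiff inE gE; apply: contraLR => tB.
  rewrite (negPf tB) /=; have [->|ttau] := eqVneq t tau.
    by rewrite tau3 subsetUr.
  rewrite addFb; apply: contra tB => /andP[tsig /eqP t3].
  have wt : w \in t.
    apply: contraNT ttau => wt; rewrite eqEcard t3 tau3 andbT.
    apply/subsetP=> x xt; have := subsetP tsig x xt; rewrite in_setU1 => /orP[/eqP xw|//].
    by rewrite -xw xt in wt.
  rewrite -(setD1K wt); apply: wO; rewrite -bdry_tau bdry_simplex tau3.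
  by rewrite subDset tsig; move: t3; rewrite (cardsD1 w) wt add1n => ->.
have K0E : symdiff K0 g = set0 := nB _ KB K_cycle.
(* So [B] lies in the boundary of a tetrahedron, which has only four faces. *)
have : #|B| <= #|g|.
  apply/subset_leq_card/subsetP=> t tB; have /setP/(_ t) := K0E.
  rewrite !in_symdiff tB in_set1 in_set0.
  have -> : (t == tau) = false by apply: contraNF tauB => /eqP <-.
  by case: (t \in g).
have -> : g = [set t : {set V} | t \subset sig & #|t| == 3].
  by apply/setP=> t; rewrite gE inE.
by rewrite cards_draws csig B15.
Qed.

End Chains.

(** * Three-dimensional complexes on seven vertices *)

(* The unknown is the set of triples whose complement lies in [B].  A triple is
   represented by its rank in [triples], a set of triples by a bit sequence. *)
Definition submask (m1 m2 : bitseq) := all2 implb m1 m2.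
Definition weight k := [seq m <- bitseqs 7 | count id m == k].
Definition triples := Eval vm_compute in weight 3.
(** A 4-set is the complement of a ridge, and the number of chosen triples in it is the degree of
    that ridge. *)
Definition quads := Eval vm_compute in
  [seq [seq index t triples | t <- triples & submask t q] | q <- weight 4].
Definition stars := Eval vm_compute in
  [seq [seq index t triples | t <- triples & submask e t] | e <- weight 2].
(* Coboundaries of the edges that avoid the last vertex; they generate all
   coboundaries of edges. *)
Definition star_vecs := Eval vm_compute in
  [seq [seq submask e t | t <- triples] | e <- weight 2 & ~~ nth false e 6].
Definition quads_of := Eval vm_compute in
  [seq [seq q <- quads | i \in q] | i <- iota 0 35].
Definition stars_of := Eval vm_compute in
  [seq [seq q <- stars | i \in q] | i <- iota 0 35].

(* A partial assignment [s] holds [Some true] for the triples known to be in the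
   set and [Some false] for those known not to be.  [tally] counts the latter and
   the former in [q], and returns an undecided member of [q]. *)
Fixpoint tally (s : seq (option bool)) (q : seq nat) : nat * nat * option nat :=
  if q is i :: q' then
    let: (nf, nt, u) := tally s q' in
    match nth None s i with
    | Some true => (nf, nt.+1, u)
    | Some false => (nf.+1, nt, u)
    | None => (nf, nt, Some i)
    end
  else (0, 0, None).

Definition violated s q := if tally s q is (3, 1, _) then true else false.

Definition crowded lim s q := let: (_, nt, _) := tally s q in lim < nt.

Definition clash lim s i :=
  has (violated s) (nth [::] quads_of i) || has (crowded lim s) (nth [::] stars_of i).

(* [pick] only guides the search: its outcome needs no correctness proof.  The flag
   tells that one of the two values for the chosen triple clashes at once. *)
Fixpoint pick_star lim s (qs : seq (seq nat)) (best : nat) : nat * bool :=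
  if qs is q :: qs' then
    match tally s q with
    | (_, nt, Some i) => if nt == lim then (i, true) else pick_star lim s qs' best
    | _ => pick_star lim s qs' best
    end
  else (best, false).

Fixpoint pick lim s (qs : seq (seq nat)) (score best : nat) : nat * bool :=
  if qs is q :: qs' then
    match tally s q with
    | (3, 0, Some i) | (2, 1, Some i) => (i, true)
    | (nf, nt, Some i) =>
      let sc := if nt < 2 then (2 * nf + nt).+1 else 1 in
      if score < sc then pick lim s qs' sc i else pick lim s qs' score best
    | _ => pick lim s qs' score best
    end
  else pick_star lim s stars best.

Fixpoint xorv (v w : bitseq) : bitseq :=
  match v, w with
  | a :: v', b :: w' => addb a b :: xorv v' w'
  | _, _ => [::]
  end.

(* Gaussian elimination: a basis of the vectors spanned by [W] that vanish at [i]. *)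
Fixpoint elim i (W : seq bitseq) : seq bitseq :=
  if W is w :: W' then
    if nth false w i then [seq if nth false h i then xorv h w else h | h <- W']
    else w :: elim i W'
  else [::].

(** Only undecided positions are eliminated here; those with value [false] have been eliminated
    during the search. *)
Fixpoint reduce (s : seq (option bool)) i (W : seq bitseq) : seq bitseq :=
  match W, s with
  | [::], _ => [::]
  | _, None :: s' => reduce s' i.+1 (elim i W)
  | _, Some _ :: s' => reduce s' i.+1 W
  | _, [::] => W
  end.

Fixpoint inside (w : bitseq) (s : seq (option bool)) :=
  match w, s with
  | [::], _ => true
  | true :: w', Some true :: s' => inside w' s'
  | false :: w', _ :: s' => inside w' s'
  | _, _ => false
  end.

(* The reduced basis spans the coboundaries supported on the triples with value
   [true]; one nonzero vector is enough for a contradiction. *)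
Definition has_cycle s W :=
  if reduce s 0 W is w :: _ then has id w && inside w s else false.

Definition set_val (s : seq (option bool)) i b := set_nth None s i (Some b).

(* [W] spans the coboundaries that avoid the triples with value [false].  The nested
   conditionals stand for [||] and [&&], which would evaluate both arguments. *)
Fixpoint search lim n s W : bool :=
  if n is n'.+1 then
    let: (i, forced) := pick lim s quads 0 0 in
    if (if forced then false else has_cycle s W) then true
    else
      let s1 := set_val s i true in
      let s0 := set_val s i false in
      if (if clash lim s1 i then true else search lim n' s1 W) then
        if clash lim s0 i then true else search lim n' s0 (elim i W)
      else false
  else false.

Definition bits_at (l : seq nat) := [seq i \in l | i <- iota 0 7].
Definition tri l := index (bits_at l) triples.

(** The fuel 36 is one more than the number of triples; running out of it makes the search fail. *)
Fixpoint search_from lim (l : seq (seq nat * bool)) s W :=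
  if l is (t, b) :: l' then
    search_from lim l' (set_val s (tri t) b) (if b then W else elim (tri t) W)
  else search lim 36 s W.

Definition refute lim l := search_from lim l (nseq 35 None) star_vecs.

(* Here 0 and 1 are the ends of an edge in as many missing triples as possible.  In
   [case1] only 012 is not missing among the triples 01x; the vertices x > 2 with 02x
   not missing come first, then those with 12x not missing.  In [case2] there are k
   triples 01x that are not missing. *)
Definition case1 p q :=
  ([:: 0; 1; 2], false) ::
  flatten [seq [:: ([:: 0; 1; x], true); ([:: 0; 2; x], 3 + p <= x)]
               ++ (if 3 + p <= x then [:: ([:: 1; 2; x], 3 + p + q <= x)] else [::])
          | x <- iota 3 4].

Definition case2 k := [seq ([:: 0; 1; x], 2 + k <= x) | x <- iota 2 5].

Lemma refute_case1 :
  all (fun p => all (fun q => refute 4 (case1 p q)) (iota 0 (5 - p))) (iota 0 5).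
Proof. by vm_compute. Qed.

(** The value 1 belongs to [case1], and 5 would leave no missing triple at 01. The limit [5 - k] is
    the number of missing triples at 01, which is maximal. *)
Lemma refute_case2 : all (fun k => refute (5 - k) (case2 k)) [:: 0; 2; 3; 4].
Proof. by vm_compute. Qed.

(** * Soundness of the search *)

Section Soundness.
Variables (x : nat -> bool) (lim : nat) (P : bitseq -> Prop).
Hypothesis no_lone : forall q, q \in quads -> count x q != 1.
Hypothesis star_le : forall q, q \in stars -> count x q <= lim.
Hypothesis P_xorv : forall v w, P v -> P w -> P (xorv v w).
Hypothesis P_not_inside :
  forall w, P w -> has id w -> exists2 i, nth false w i & ~~ x i.

Definition agrees (s : seq (option bool)) := forall i b, nth None s i = Some b -> x i = b.

Lemma tally_count s q : agrees s ->
  let: (nf, nt, _) := tally s q in nt <= count x q /\ nf + count x q <= size q.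
Proof.
move=> sx; elim: q => //= i q; case: (tally s q) => [[nf nt] u] [nt_le nf_le].
case si: (nth None s i) => [b|]; last by case: (x i); split; lia.
by rewrite (sx _ _ si); case: (b); split; lia.
Qed.

Lemma clash_sound s i : agrees s -> clash lim s i -> False.
Proof.
move=> sx /orP[]/hasP[q qi]; have := tally_count q sx.
  rewrite /violated; case: tally => [[[|[|[|[|nf]]]] [|[|nt]]] u] // [t_le f_le] _.
  have q_quads : q \in quads.
    have /allP/(_ (nth [::] quads_of i)) : all (all (mem quads)) quads_of by vm_compute.
    have [lti|gei] := ltnP i (size quads_of); last by rewrite nth_default // in qi.
    by move/(_ (mem_nth _ lti))/allP; apply.
  have /allP/(_ q q_quads)/eqP q4 : all (fun q => size q == 4) quads by vm_compute.
  by case/negP: (no_lone q_quads); lia.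
rewrite /crowded; case: tally => [[nf nt] u] [t_le _].
apply/negP; rewrite -leqNgt; apply: leq_trans t_le _; apply: star_le.
have /allP/(_ (nth [::] stars_of i)) : all (all (mem stars)) stars_of by vm_compute.
have [lti|gei] := ltnP i (size stars_of); last by rewrite nth_default // in qi.
by move/(_ (mem_nth _ lti))/allP; apply.
Qed.

Lemma elim_sound i W : {in W, forall w, P w} -> {in elim i W, forall w, P w}.
Proof.
elim: W => //= w W IH PW; have Pw := PW w (mem_head _ _).
have PW' h : h \in W -> P h by move=> hW; apply: PW; rewrite inE hW orbT.
case: ifP => _ h; last by rewrite inE => /predU1P[->|/(IH PW')].
by case/mapP=> g /PW' Pg ->; case: ifP => _ //; apply: P_xorv.
Qed.

Lemma reduce_sound s i W : {in W, forall w, P w} -> {in reduce s i W, forall w, P w}.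
Proof.
elim: s i W => [|[b|] s IH] i [|w W] //= PW; first exact: IH.
by apply: IH; exact: (elim_sound (i := i) PW).
Qed.

Lemma inside_nth w s i : inside w s -> nth false w i -> nth None s i = Some true.
Proof.
elim: w s i => [|[] w IH] [|[[]|] s] [|i] //=; rewrite ?nth_nil //; exact: IH.
Qed.

Lemma has_cycle_sound s W :
  agrees s -> {in W, forall w, P w} -> has_cycle s W -> False.
Proof.
move=> sx /(reduce_sound (s := s) (i := 0)); rewrite /has_cycle.
case: reduce => // w W' /(_ w (mem_head _ _)) Pw /andP[w1 w_s].
have [i wi] := P_not_inside Pw w1.
by rewrite (sx i true) //; apply: inside_nth wi.
Qed.

Lemma agrees_set s i b : agrees s -> x i = b -> agrees (set_val s i b).
Proof.
move=> sx xi j c; rewrite nth_set_nth /=; case: eqP => [-> [<-]//|_]; exact: sx.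
Qed.

(* Otherwise simplification unfolds the tables inside these functions. *)
Arguments pick : simpl never.
Arguments clash : simpl never.
Arguments has_cycle : simpl never.
Arguments elim : simpl never.
Arguments set_val : simpl never.

(** A set [x] meeting all constraints would agree with one branch at every choice and so reach a
    refuted leaf. *)
Lemma search_sound n s W :
  agrees s -> {in W, forall w, P w} -> search lim n s W -> False.
Proof.
elim: n s W => //= n IH s W sx PW; case: pick => i forced.
case: ifP => [|_]; first by case: forced => // + _; apply: has_cycle_sound.
case xi: (x i).
  case: ifP => // + _; have s1 := agrees_set sx xi.
  by case: ifP => [+ _|_]; [apply: clash_sound|apply: IH].
case: ifP => // _; have s0 := agrees_set sx xi.
by case: ifP => [+ _|_]; [apply: clash_sound|apply: IH => //; apply: elim_sound].
Qed.

Lemma search_from_sound l s W :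
  agrees s -> {in W, forall w, P w} -> {in l, forall c, x (tri c.1) = c.2} ->
  search_from lim l s W -> False.
Proof.
elim: l s W => [|[t b] l IH] s W sx PW xl; first exact: search_sound.
apply: IH => [||c cl]; last by apply: xl; rewrite inE cl orbT.
  by apply: agrees_set => //; apply: (xl (t, b)); apply: mem_head.
by case: (b) => //; apply: elim_sound.
Qed.

Lemma refute_sound l :
  {in star_vecs, forall w, P w} -> {in l, forall c, x (tri c.1) = c.2} ->
  refute lim l -> False.
Proof.
by move=> Pstar; apply: search_from_sound => // i b; rewrite nth_nseq; case: ifP.
Qed.

End Soundness.

(** * Triples dual to a family on seven vertices *)

Lemma triplesE : triples = weight 3. Proof. by vm_compute. Qed.

Lemma quadsE :
  quads = [seq [seq index t triples | t <- triples & submask t q] | q <- weight 4].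
Proof. by vm_compute. Qed.

Lemma starsE :
  stars = [seq [seq index t triples | t <- triples & submask e t] | e <- weight 2].
Proof. by vm_compute. Qed.

Lemma mem_weight k m : (m \in weight k) = (count id m == k) && (size m == 7).
Proof. by rewrite mem_filter mem_bitseqs. Qed.

Lemma uniq_triples : uniq triples. Proof. by vm_compute. Qed.

Lemma card_setD1 (T : finType) (A : {set T}) x k : x \in A -> #|A| = k.+1 -> #|A :\ x| = k.
Proof. by rewrite (cardsD1 x) => ->; rewrite add1n => -[]. Qed.

Section Seven.
Variables (V : finType) (us : seq V) (B : {set {set V}}).
Hypotheses (uniq_us : uniq us) (size_us : size us = 7) (mem_us : forall y, y \in us).
Hypotheses (sB : ridge_stuck B) (nB : no_cycle B).
Implicit Types (s C D e : {set V}) (G : {set {set V}}) (m t : bitseq).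

Let usT : [set y in us] = setT. Proof. by apply/setP=> y; rewrite !inE mem_us. Qed.

Lemma codeK7 s : decode us (code us s) = s.
Proof. by rewrite codeK // usT subsetT. Qed.

Lemma count_code7 s : count id (code us s) = #|s|.
Proof. by rewrite count_code // usT subsetT. Qed.

Lemma weight_decode k m : m \in weight k -> code us (decode us m) = m /\ #|decode us m| = k.
Proof.
rewrite mem_weight => /andP[/eqP cm /eqP sm].
have mE := decodeK uniq_us size_us sm; split=> //.
by rewrite -count_code7 mE.
Qed.

Lemma weight_code k s : (code us s \in weight k) = (#|s| == k).
Proof. by rewrite mem_weight count_code7 (size_code size_us) eqxx andbT. Qed.

Lemma submask_code s C : submask (code us s) (code us C) = (s \subset C).
Proof.
have -> : submask (code us s) (code us C) = all (fun y => (y \in s) ==> (y \in C)) us.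
  by rewrite /submask /code; elim: (us) => //= y l ->.
apply/allP/subsetP=> st y; first by move=> ys; have /implyP := st y (mem_us y); apply.
by move=> _; apply/implyP; apply: st.
Qed.

Lemma card7 : #|V| = 7.
Proof. by rewrite -size_us -(card_uniqP uniq_us); apply/esym/eq_card=> y; rewrite mem_us. Qed.

(* The triple of rank [i] is missing from the Alexander dual. *)
Definition missing i := ~: decode us (nth [::] triples i) \in B.

Lemma missing_index t : t \in triples -> missing (index t triples) = (~: decode us t \in B).
Proof. by move=> tT; rewrite /missing nth_index. Qed.

Lemma count_missing (r : pred bitseq) :
  count missing [seq index t triples | t <- triples & r t] =
  size [seq t <- triples | r t & ~: decode us t \in B].
Proof.
rewrite count_map -size_filter -filter_predI; congr size.
by apply: eq_in_filter => t tT /=; rewrite missing_index // andbC.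
Qed.

(** If [C :\ y] were the only missing triple in a 4-set [C], the ridge [~: C] would have the single
    vertex [y] in its link. *)
Lemma missing_no_lone q : q \in quads -> count missing q != 1.
Proof.
rewrite quadsE => /mapP[m m4 ->]; rewrite count_missing; apply/negP.
case LE: [seq _ <- _ | _ & _] => [|t0 [|]] // _.
have inL t : (t \in [:: t0]) = [&& submask t m, ~: decode us t \in B & t \in triples].
  by rewrite -LE mem_filter andbA.
have /and3P[t0m t0B t0T] : [&& submask t0 m, ~: decode us t0 \in B & t0 \in triples].
  by rewrite -inL mem_head.
rewrite triplesE in t0T; have [t0E D3] := weight_decode t0T.
have [mE C4] := weight_decode m4; set C := decode us m in mE C4.
have DC : decode us t0 \subset C by rewrite -submask_code t0E mE.
have /eqP/cards1P[y yE] : #|C :\: decode us t0| = 1.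
  by rewrite cardsD (setIidPr DC) C4 D3.
case/negP: (sB (~: C)); rewrite (_ : link B _ = [set y]) ?cards1 // -yE.
apply/setP=> z; rewrite inE in_setC negbK setU1C in_setD.
case: (boolP (z \in C)) => zC; rewrite ?andbT ?andbF //=.
apply/idP/idP=> [zB|zD].
  have : code us (C :\ z) \in [:: t0].
    rewrite inL codeK7 zB triplesE weight_code -mE submask_code subsetDl.
    by rewrite (card_setD1 zC C4).
  by rewrite inE => /eqP <-; rewrite codeK7 !inE eqxx.
suff -> : C :\ z = decode us t0 by [].
have : z \in [set y] by rewrite -yE inE zD.
move/set1P->; apply/eqP; rewrite eq_sym eqEcard subsetD1 DC D3.
have /setDP[yC ->] : y \in C :\: decode us t0 by rewrite yE set11.
by rewrite (card_setD1 yC C4).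
Qed.

Definition missing_at e := [set z | (z \notin e) && (~: (z |: e) \in B)].

Lemma missing_star q lim : (forall e, #|e| = 2 -> #|missing_at e| <= lim) ->
  q \in stars -> count missing q <= lim.
Proof.
move=> le_lim; rewrite starsE => /mapP[m /weight_decode[mE e2] ->].
rewrite count_missing; apply: leq_trans (le_lim _ e2).
set e := decode us m in mE e2 *.
rewrite cardE -(size_map (fun z => code us (z |: e))).
apply: uniq_leq_size; first by rewrite filter_uniq // uniq_triples.
move=> t; rewrite mem_filter => /andP[/andP[mt tB]].
rewrite triplesE => /weight_decode[tE D3].
have eD : e \subset decode us t by rewrite -submask_code mE tE.
have /eqP/cards1P[z zE] : #|decode us t :\: e| = 1.
  by rewrite cardsD (setIidPr eD) e2 D3.
have DE : z |: e = decode us t.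
  by rewrite -(setID (decode us t) e) (setIidPr eD) zE setUC.
apply/mapP; exists z; last by rewrite DE tE.
rewrite mem_enum inE DE tB andbT.
by have := set11 z; rewrite -zE inE => /andP[].
Qed.

(** On triples [D] this is the coboundary of the graph [G]. *)
Definition edge_sum G D := \big[addb/false]_(e : {set V} | e \subset D) (e \in G).

Definition coboundary w :=
  exists2 G, uniform 2 G & w = [seq edge_sum G (decode us t) | t <- triples].

Lemma coboundary_xorv v w : coboundary v -> coboundary w -> coboundary (xorv v w).
Proof.
case=> [G uG ->] [H uH ->]; exists (symdiff G H).
  by move=> e; rewrite in_symdiff; case: (boolP (e \in G)) => [/uG|_ /uH].
elim: triples => //= t l ->; congr cons; rewrite /edge_sum -big_split.
by apply: eq_bigr => e _; rewrite in_symdiff.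
Qed.

Lemma star_vecs_coboundary : {in star_vecs, forall w, coboundary w}.
Proof.
have -> : star_vecs = [seq [seq submask m t | t <- triples] | m <- weight 2 & ~~ nth false m 6].
  by vm_compute.
move=> w /mapP[m]; rewrite mem_filter => /andP[_ /weight_decode[mE m2]] ->.
rewrite -mE; move: (decode us m) m2 => e e2 {mE}.
exists [set e]; first by move=> f /set1P ->.
apply/eq_in_map=> t; rewrite triplesE => /weight_decode[tE _].
rewrite -{1}tE submask_code /edge_sum big_mkcond (bigD1 e) // set11.
rewrite big1 => [|f /negPf fe]; last by rewrite in_set1 fe; case: ifP.
by rewrite /= addbF; case: ifP.
Qed.

(** Dually, the coboundary of a coboundary vanishes: an edge in a 4-set lies in exactly two of its
    triples. *)
Lemma edge_sum_cycle G :
  uniform 2 G -> cycle [set s : {set V} | (#|s| == 4) && edge_sum G (~: s)].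
Proof.
move=> uG; set c := finset _.
have uc : uniform 4 c by move=> s; rewrite inE => /andP[/eqP].
apply: (uniform_cycle uc) => e e3.
have C4 : #|~: e| = 4 by apply: (@addnI 3); rewrite -{1}e3 cardsC card7.
have -> : bdry c e = \big[addb/false]_(y in ~: e) edge_sum G (~: e :\ y).
  apply: eq_big => [y|y ye]; first by rewrite inE.
  by rewrite inE cardsU1 ye e3 /= setCU setIC -setDE.
rewrite /edge_sum (exchange_big_dep (fun f : {set V} => f \subset ~: e)) /=; last first.
  by move=> y f _ /subset_trans; apply; apply: subsetDl.
rewrite big1 // => f fC; have [fG|_] := boolP (f \in G); last by rewrite big1.
rewrite addb_card (_ : [set y | _] = ~: e :\: f).
  by rewrite cardsD (setIidPr fC) C4 (uG _ fG).
by apply/setP=> y; rewrite !inE subsetD1 fC andbT andbC.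
Qed.

(** Otherwise the complements of the triples in [w] would form a nonempty cycle inside [B]. *)
Lemma coboundary_not_inside w :
  coboundary w -> has id w -> exists2 i, nth false w i & ~~ missing i.
Proof.
case=> G uG wE w1.
have [/hasP[i _ /andP[]]|] := boolP (has (fun i => nth false w i && ~~ missing i) (iota 0 35)).
  by exists i.
rewrite -all_predC => /allP miss.
have sum_missing s : #|s| = 4 -> edge_sum G (~: s) -> s \in B.
  move=> s4 sum_s; have s3 : #|~: s| = 3.
    by apply: (@addnI 4); rewrite -{1}s4 cardsC card7.
  have sT : code us (~: s) \in triples by rewrite triplesE weight_code s3.
  have lti : index (code us (~: s)) triples < 35 by rewrite -(_ : size triples = 35) // index_mem.
  have := miss (index (code us (~: s)) triples); rewrite mem_iota lti => /(_ isT) /=.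
  rewrite wE (nth_map [::]) ?index_mem // nth_index // codeK7 sum_s negbK /=.
  by rewrite missing_index // codeK7 setCK.
have : [set s : {set V} | (#|s| == 4) && edge_sum G (~: s)] = set0.
  apply: nB; last exact: edge_sum_cycle.
  by apply/subsetP=> s; rewrite inE => /andP[/eqP /sum_missing].
rewrite wE in w1; have /hasP[_ /mapP[t tT ->] sum_t] := w1.
rewrite triplesE in tT; have [tE t3] := weight_decode tT.
move/setP/(_ (~: decode us t)); rewrite !inE setCK sum_t andbT.
by rewrite cardsCs setCK t3 card7.
Qed.

Lemma refute_missing lim l : (forall e, #|e| = 2 -> #|missing_at e| <= lim) ->
  {in l, forall c, missing (tri c.1) = c.2} -> refute lim l -> False.
Proof.
move=> le_lim; apply: refute_sound.
- exact: missing_no_lone.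
- by move=> q; apply: missing_star.
- exact: coboundary_xorv.
- exact: coboundary_not_inside.
exact: star_vecs_coboundary.
Qed.

End Seven.

Lemma mem_index_cat (T : eqType) (s1 s2 : seq T) y :
  (y \in s1) = (index y (s1 ++ s2) < size s1).
Proof. by rewrite index_cat -index_mem; case: ifP => // _; rewrite ltnNge leq_addr. Qed.

(** * Choosing the vertex order for the search *)

Section Dim3.
Variables (V : finType) (B : {set {set V}}).
Hypotheses (uB : uniform 4 B) (sB : ridge_stuck B) (nB : no_cycle B) (V7 : #|V| = 7).

Lemma missing_tri (us : seq V) a l :
  uniq us -> size us = 7 -> (forall y, y \in us) -> bits_at l \in triples ->
  missing us B (tri l) = (~: [set y in [seq nth a us i | i <- l & i < 7]] \in B).
Proof.
move=> uniq_us size_us mem_us lT; rewrite missing_index //; congr (~: _ \in B).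
apply/setP=> y; rewrite !inE mem_us /=; have y7 : index y us < 7 by rewrite -size_us index_mem.
rewrite (nth_map 0) ?size_iota // nth_iota // add0n.
apply/idP/mapP=> [yl|[i]]; first by exists (index y us); rewrite ?mem_filter ?y7 ?nth_index.
by rewrite mem_filter => /andP[i7 il] ->; rewrite index_uniq ?size_us.
Qed.

Lemma uniq_spanning (us : seq V) : size us = 7 -> (forall y, y \in us) -> uniq us.
Proof.
move=> size_us mem_us; apply: (leq_size_uniq (enum_uniq V)) => [y _|]; first exact: mem_us.
by rewrite size_us -cardE V7.
Qed.

Lemma stuck_dim3_7 : B = set0.
Proof.
apply/eqP/set0Pn=> -[t0 t0B].
have [e1 e1_2 m1] : exists2 e : {set V}, #|e| = 2 & 0 < #|missing_at B e|.
  have t3 : #|~: t0| = 3 by apply: (@addnI 4); rewrite -{1}(uB t0B) cardsC V7.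
  have [z zt] : exists z, z \in ~: t0 by apply/card_gt0P; rewrite t3.
  exists (~: t0 :\ z); first exact: (card_setD1 zt t3).
  by apply/card_gt0P; exists z; rewrite !inE eqxx setD1K // setCK.
pose P2 := [pred e : {set V} | #|e| == 2].
have P1 : P2 e1 by apply/eqP.
case: (arg_maxnP (fun e => #|missing_at B e|) P1) => e /eqP e2 max_e {P1}.
have le_m (f : {set V}) : #|f| = 2 -> #|missing_at B f| <= #|missing_at B e|.
  by move=> f2; apply: max_e; apply/eqP.
(* The third vertices of the triples on [e] that are not missing; their number is the parameter of
   [case2]. *)
pose N := ~: e :\: missing_at B e.
have MC : missing_at B e \subset ~: e by apply/subsetP=> z; rewrite !inE => /andP[].
have C5 : #|~: e| = 5 by apply: (@addnI 2); rewrite -{1}e2 cardsC V7.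
have cNM : #|missing_at B e| = 5 - #|N|.
  by rewrite cardsD (setIidPr MC) C5 subKn // -C5 subset_leq_card.
have NE (z : V) : z \in N -> ~: (z |: e) \notin B.
  by rewrite !inE negb_and => /andP[/orP[/negPn ze|//]]; rewrite ze.
have /cards2P[a [b [ab eE]]] : #|e| == 2 by rewrite e2.
have k4 : #|N| <= 4.
  by rewrite -ltnS -(subn_gt0 #|N|) -cNM (leq_trans m1) // le_m.
have [k1|k1] := eqVneq #|N| 1; last first.
  (* The order that [case2] expects: the ends of [e], then [N], then the rest. *)
  pose us := [:: a; b] ++ enum N ++ enum (missing_at B e).
  have size_us : size us = 7.
    by rewrite !size_cat -!cardE cNM subnKC // ltnW.
  have mem_us y : y \in us.
    have yab : (y \in [:: a; b]) = (y \in e) by rewrite eE !inE.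
    rewrite mem_cat mem_cat yab !mem_enum in_setD in_setC.
    by case: (y \in e); case: (y \in missing_at B e).
  have uniq_us := uniq_spanning size_us mem_us.
  apply: (@refute_missing V us B uniq_us size_us mem_us sB nB (5 - #|N|) (case2 #|N|)).
  - by move=> f f2; rewrite -cNM le_m.
  - move=> c /mapP[x x25 ->] /=.
    have bT : bits_at [:: 0; 1; x] \in triples.
      by move: x x25; apply/allP; vm_compute.
    move: x25; rewrite mem_iota => /andP[x2 x7].
    rewrite (missing_tri a) //= x7 /=.
    set y := nth a us x; have yi : index y us = x by rewrite index_uniq ?size_us.
    have -> : [set y0 in [:: a; b; y]] = y |: e.
      by apply/setP=> z; rewrite eE !inE; do 3 case: eqP.
    have yus : y \in us by rewrite mem_us.
    have yN : (y \in [:: a; b] ++ enum N) = (x < 2 + #|N|).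
      by rewrite (mem_index_cat _ (enum (missing_at B e))) -catA yi size_cat -cardE.
    have yab : y \notin [:: a; b].
      by rewrite (mem_index_cat _ (enum N ++ enum (missing_at B e))) yi -leqNgt.
    move: yN; rewrite mem_cat (negPf yab) mem_enum /= => yN.
    rewrite leqNgt -yN; case: (boolP (y \in N)) => [/NE/negPf //|yN'].
    move: yus; rewrite mem_cat (negPf yab) mem_cat !mem_enum (negPf yN') /=.
    by rewrite inE => /andP[].
  have /allP/(_ #|N|) := refute_case2; apply.
  by move: k4 k1; case: #|N| => [|[|[|[|[|]]]]].
have /cards1P[c NcE] : #|N| == 1 by rewrite k1.
have cN : c \in N by rewrite NcE set11.
have ce : c \notin e by move: cN; rewrite !inE => /andP[].
pose N0 := [set z in missing_at B e | ~: [set a; c; z] \notin B].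
pose N1 := [set z in missing_at B e :\: N0 | ~: [set b; c; z] \notin B].
pose R := (missing_at B e :\: N0) :\: N1.
(* The order that [case1] expects, with [a], [b], [c] as 0, 1, 2. *)
pose us := ([:: a; b; c] ++ enum N0) ++ enum N1 ++ enum R.
have sN0 : N0 \subset missing_at B e by apply/subsetP=> z; rewrite inE => /andP[].
have sN1 : N1 \subset missing_at B e :\: N0 by apply/subsetP=> z; rewrite inE => /andP[].
have cR : #|N0| + (#|N1| + #|R|) = 4.
  rewrite /R [#|_ :\: N1|]cardsD (setIidPr sN1) subnKC ?subset_leq_card //.
  by rewrite cardsD (setIidPr sN0) subnKC ?subset_leq_card // cNM k1.
have size_us : size us = 7 by rewrite !size_cat -!cardE -addnA cR.
have mem_us y : y \in us.
  have yabc : (y \in [:: a; b; c]) = (y \in e) || (y \in N).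
    by rewrite eE NcE !inE orbA.
  rewrite !mem_cat yabc !mem_enum [y \in R]in_setD [y \in N]in_setD in_setC.
  rewrite [y \in missing_at B e :\: N0]in_setD.
  by case: (y \in e); case: (y \in missing_at B e); case: (y \in N0); case: (y \in N1).
have uniq_us := uniq_spanning size_us mem_us.
have pq4 : #|N1| < 5 - #|N0| by rewrite ltn_subRL -cR ltnS leq_add2l leq_addr.
have p4 : #|N0| < 5 by rewrite ltnS -cR leq_addr.
apply: (@refute_missing V us B uniq_us size_us mem_us sB nB 4 (case1 #|N0| #|N1|)).
- by move=> f f2; rewrite (leq_trans (le_m _ f2)) // cNM k1.
- have ltv x : x < 7 -> index (nth a us x) us = x by move=> x7; rewrite index_uniq ?size_us.
  have setE (y1 y2 y3 : V) : [set y in [:: y1; y2; y3]] = [set y1; y2; y3].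
    by apply/setP=> y; rewrite !inE orbA.
  move=> d; rewrite in_cons => /predU1P[->|/flattenP[_ /mapP[x x37 ->]]].
    rewrite (missing_tri a) // setE /= -eE setUC; apply/negbTE; exact: NE.
  move: (x37); rewrite mem_iota => /andP[x3 x7].
  set y := nth a us x; have yi : index y us = x by apply: ltv.
  have yN0 : (y \in [:: a; b; c] ++ enum N0) = (x < 3 + #|N0|).
    by rewrite (mem_index_cat _ (enum N1 ++ enum R)) yi size_cat -cardE.
  have yabc : y \notin [:: a; b; c].
    have usE : us = [:: a; b; c] ++ enum N0 ++ enum N1 ++ enum R by rewrite /us -catA.
    by rewrite (mem_index_cat _ (enum N0 ++ enum N1 ++ enum R)) -usE yi -leqNgt.
  move: (yN0); rewrite mem_cat (negPf yabc) mem_enum /= => yN0'.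
  have yM : y \in missing_at B e.
    move: yabc; have -> : (y \in [:: a; b; c]) = (y \in e) || (y \in N).
      by rewrite eE NcE !inE orbA.
    by rewrite negb_or [y \in N]in_setD in_setC => /andP[->]; rewrite andbT negbK.
  have triT (l : seq nat) : bits_at l \in triples -> missing us B (tri l) =
      (~: [set z in [seq nth a us i | i <- l & i < 7]] \in B).
    exact: missing_tri.
  have bT : all (fun x => [&& bits_at [:: 0; 1; x] \in triples,
      bits_at [:: 0; 2; x] \in triples & bits_at [:: 1; 2; x] \in triples]) (iota 3 4).
    by vm_compute.
  have /and3P[T01 T02 T12] := allP bT x x37.
  rewrite !in_cons => /or3P[/eqP->|/eqP->|] /=.
  - rewrite triT //= x7 setE -eE setUC; move: yM; rewrite inE => /andP[_].
    by [].
  - by rewrite triT //= x7 setE leqNgt -yN0' inE yM negbK.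
  case: ifP => // px; rewrite inE => /eqP->; rewrite /= triT //= x7 setE.
  have yN1 : (y \in ([:: a; b; c] ++ enum N0) ++ enum N1) = (x < 3 + #|N0| + #|N1|).
    have usE : us = (([:: a; b; c] ++ enum N0) ++ enum N1) ++ enum R by rewrite /us -!catA.
    by rewrite (mem_index_cat _ (enum R)) -usE yi !size_cat -!cardE.
  move: yN1; rewrite mem_cat yN0 ltnNge px mem_enum /= => yN1.
  by rewrite leqNgt -yN1 [y \in N1]in_set in_setD yN0' ltnNge px yM /= negbK.
have /allP/(_ #|N0|) := refute_case1; rewrite mem_iota => /(_ p4).
by move/allP/(_ #|N1|); rewrite mem_iota => /(_ pq4).
Qed.

End Dim3.

(** * The cases of part (ii) combined *)

Lemma no_stuck_faces (V : finType) (Y : {set {set V}}) (v : V) d :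
    collapses setT Y -> stuck Y -> (forall t, t \in Y -> #|t| <= d.+1) -> 0 < d ->
    #|V| <= 7 \/ [\/ d = 1, d + 3 = #|V|, d + 2 = #|V| | d + 1 = #|V|] ->
  [set t in Y | #|t| == d.+1] = set0.
Proof.
move=> colY stuckY dimY d_gt0; set B := finset _ => small.
have uB : uniform d.+1 B by move=> t; rewrite inE => /andP[_ /eqP].
have nB : no_cycle B := no_top_cycle v colY dimY.
have sB : ridge_stuck B.
  move=> e; have [ed|ed] := eqVneq #|e| d; last first.
    rewrite (_ : link B e = set0) ?cards0 //; apply/setP=> x; rewrite [RHS]inE.
    by apply: contraNF ed => /(link_card uB) ->.
  (* Adding a vertex to [d] vertices gives the size of the members of [B]. *)
  have -> : link B e = link Y e.
    apply/setP=> x; rewrite !inE; case: (boolP (x \in e)) => //= xe.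
    by rewrite cardsU1 xe ed eqxx andbT.
  by apply: stuckY; rewrite -card_gt0 ed.
have [lecV|ltcV] := leqP #|V| d.+2; first exact: stuck_codim2 lecV.
have [cV|cV] := eqVneq #|V| d.+3; first exact: stuck_codim3 cV.
have [d1|d1] := eqVneq d 1; first by rewrite d1 in uB; apply: stuck_dim1.
have cV7 : #|V| <= 7 by case: small => [//|[]]; lia.
have [d2|d2] := eqVneq d 2; first by rewrite d2 in uB; apply: stuck_dim2.
(* What remains is [d >= 3] with [d + 4 <= #|V| <= 7]. *)
have [d3 V7] : d = 3 /\ #|V| = 7 by split; lia.
by rewrite d3 in uB; apply: stuck_dim3_7.
Qed.

Theorem theorem1 :
  (forall n d : nat, 8 <= n -> 2 <= d -> d + 4 <= n ->
     exists (Xs : seq {set {set 'I_n}}) (Y : {set {set 'I_n}}),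
       [/\ gets_stuck_at (full_simplex 'I_n) Xs Y,
           simplicial_complex Y,
           complex_dim Y = d%:Z%R
         & forall v : 'I_n, [set v] \in Y])
  /\
  (forall n d : nat, 1 <= n -> 1 <= d ->
     n <= 7 \/ [\/ d = 1, d + 3 = n, d + 2 = n | d + 1 = n] ->
     ~ exists Xs : seq {set {set 'I_n}},
         gets_stuck_at_dim (full_simplex 'I_n) Xs d%:Z%R).
Proof.
split=> n d.
  by move=> n8 d2 dn; apply/sticks_at_full/(@sticks_at_ge8 _ n); rewrite ?cardsT ?card_ord.
case: n => // n _ d_gt0 small [Xs [Y [[pXs lXs freeY] cY /complex_dimP[dimY [F FY cF]]]]].
have colY : collapses (full_simplex 'I_n.+1) Y.
  by rewrite -lXs; apply: seq_collapses => //; apply: full_simplex_complex.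
have := no_stuck_faces ord0 colY (proj2 (stuckP cY) freeY) dimY d_gt0.
rewrite card_ord => /(_ small)/setP/(_ F).
by rewrite !inE FY cF eqxx.
Qed.
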